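(* Let $p\colon \mathcal{A}\to G$ be a Fell bundle over a locally compact Hausdorff second countable étale groupoid $G$, let $c\colon G\to\mathbb{R}$ be a $1$-cocycle with boundary set $Z$, and let $\sigma^c$ be the real dynamics on $\mathrm{C}^*(G;\mathcal{A})$ induced by $c$. Assume that $Z\neq\emptyset$ and that the groupoid $c^{-1}(0)$ is étale. Let $\varphi$ be a state on $\mathrm{C}^*(G(Z);\mathcal{A}|_{G(Z)})$ and let $\psi_\varphi$ be the $\sigma^c$-ground state on $\mathrm{C}^*(G;\mathcal{A})$ determined by $\psi_\varphi(f)=\varphi(f|_{G(Z)})$ for $f\in\mathrm{C_c}(G;\mathcal{A})$. If $\psi_\varphi$ is a KMS$_\infty$ state, then $\varphi$ is tracial.
   Context: Groupoids: $r(\gamma)=\gamma\gamma^{-1}$, $s(\gamma)=\gamma^{-1}\gamma$, unit space $G^{(0)}$, $G^x=r^{-1}(x)$, $G_x=s^{-1}(x)$; $G$ is étale if $r$ is a local homeomorphism. A $1$-cocycle is a continuous groupoid homomorphism $c\colon G\to\mathbb{R}$. Boundary: $Z=\{x\in G^{(0)}: c\le 0\text{ on }G^x\}=\{x\in G^{(0)}: c\ge 0\text{ on }G_x\}$, and $G(Z)=r^{-1}(Z)\cap s^{-1}(Z)$ with the subspace topology, a closed subgroupoid of $G$. It is known that if $c^{-1}(0)$ is étale then so is $G(Z)$. Fell bundles: an upper semicontinuous Banach bundle $p\colon\mathcal{A}\to G$ is a topological space $\mathcal{A}$ with a continuous open surjection $p$ whose fibres $\mathcal{A}_\gamma=p^{-1}(\gamma)$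 are complex Banach spaces, such that $a\mapsto\|a\|$ is upper semicontinuous, fibrewise addition and scalar multiplication are continuous, and $\|a_i\|\to0$, $p(a_i)\to\gamma$ imply $a_i\to 0_\gamma$. A Fell bundle is such a bundle with a continuous (bilinear, associative) multiplication $\{(a,b):s(p(a))=r(p(b))\}\to\mathcal{A}$ and a continuous (conjugate-linear, antimultiplicative) involution $a\mapsto a^*$ such that $p(ab)=p(a)p(b)$; $p(a^* )=p(a)^{-1}$; $\mathcal{A}_x$ is a $\mathrm{C}^*$-algebra for $x\in G^{(0)}$; and each $\mathcal{A}_\gamma$ is an $\mathcal{A}_{r(\gamma)}$-$\mathcal{A}_{s(\gamma)}$-imprimitivity bimodule with inner products $ab^*$ (left) and $a^*b$ (right). Fell bundles are saturated: $\mathrm{span}\,\mathcal{A}_\gamma\mathcal{A}_\eta$ is dense in $\mathcal{A}_{\gamma\eta}$ for composable $\gamma,\eta$. $\mathrm{C_c}(G;\mathcal{A})$ is the $^*$-algebra of continuous compactly supported sections with $f*g(\gamma)=\sum_{\alpha\beta=\gamma}f(\alpha)g(\beta)$ and $f^*(\gamma)=f(\gamma^{-1})^*$. The $I$-norm is $\|f\|_I=\max\{\sup_x\sum_{\gamma\in G^x}\|f(\gamma)\|,\sup_x\sum_{\gamma\in G_x}\|f(\gamma)\|\}$. $\mathrm{C}^*(G;\mathcal{A})$ is the completion of $\mathrm{C_c}(G;\mathcal{A})$ in the norm $\|f\|=\sup\|\pi(f)\|$ over all $^*$-representations $\pi$ on Hilbert spaces with $\|\pi(f)\|\le\|f\|_I$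 for all $f$. For a closed étale subgroupoid $K$, $\mathcal{A}|_K$ denotes the restricted Fell bundle over $K$ and $\mathrm{C}^*(K;\mathcal{A}|_K)$ is defined in the same way. Dynamics: $\sigma^c_t(f)(\gamma)=e^{itc(\gamma)}f(\gamma)$ for $f\in\mathrm{C_c}(G;\mathcal{A})$, $t\in\mathbb{R}$. Let $\sigma$ be a one-parameter automorphism group of a $\mathrm{C}^*$-algebra $A$; $b\in A$ is analytic if $t\mapsto\sigma_t(b)$ extends to an entire function $z\mapsto\sigma_z(b)$. A state $\psi$ is a $\sigma$-ground state if $z\mapsto\psi(a\sigma_z(b))$ is bounded on $\{\mathrm{Im}\,z\ge0\}$ for all $a\in A$ and analytic $b$. For $\beta\in\mathbb{R}$, $\psi$ is a KMS$_\beta$ state if $\psi(ab)=\psi(b\sigma_{i\beta}(a))$ for all analytic $a,b$. A KMS$_\infty$ state is a weak$^*$-limit of a net of KMS$_{\beta_i}$ states with $\beta_i\to\infty$. It is known that under the hypotheses each state $\varphi$ of $\mathrm{C}^*(G(Z);\mathcal{A}|_{G(Z)})$ determines a unique $\sigma^c$-ground state $\psi_\varphi$ as described in the claim. A state $\varphi$ is tracial if $\varphi(ab)=\varphi(ba)$ for all $a,b$. *)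

(* Defs.v *)
From HB Require Import structures.
From mathcomp Require Import all_boot all_order all_algebra complex.
From mathcomp Require Import all_classical all_reals all_analysis.

Set Implicit Arguments.
Unset Strict Implicit.
Unset Printing Implicit Defensive.

Import Order.TTheory GRing.Theory Num.Theory numFieldNormedType.Exports.

Local Open Scope classical_set_scope.
Local Open Scope ring_scope.
Local Open Scope complex_scope.

(** The multiplication is a total function whose values are meaningful only on
    composable pairs: every axiom is restricted to such pairs. *)
Section GroupoidAxioms.
Variables (T : Type) (mul : T -> T -> T) (inv : T -> T).

Let r x := mul x (inv x).
Let s x := mul (inv x) x.

Record is_groupoid : Prop := IsGroupoid {
  groupoid_invK : forall x, inv (inv x) = x;
  groupoid_rM : forall x y, s x = r y -> r (mul x y) = r x;
  groupoid_sM : forall x y, s x = r y -> s (mul x y) = s y;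
  groupoid_mulA : forall x y z, s x = r y -> s y = r z ->
    mul x (mul y z) = mul (mul x y) z;
  groupoid_mul_r : forall x, mul (r x) x = x;
  groupoid_mul_s : forall x, mul x (s x) = x }.

End GroupoidAxioms.

Record topGroupoid := TopGroupoid {
  gcar :> topologicalType;
  gmul : gcar -> gcar -> gcar;
  ginv : gcar -> gcar;
  g_groupoid : is_groupoid gmul ginv;
  g_mul_continuous :
    {within [set xy : gcar * gcar |
               gmul (ginv xy.1) xy.1 = gmul xy.2 (ginv xy.2)],
       continuous (fun xy : gcar * gcar => gmul xy.1 xy.2)};
  g_inv_continuous : continuous ginv }.

Section GroupoidTheory.
Variable G : topGroupoid.

Definition grng (x : G) : G := gmul x (ginv x).
Definition gsrc (x : G) : G := gmul (ginv x) x.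
Definition composable (x y : G) : Prop := gsrc x = grng y.
Definition units : set G := range grng.

(** [grng], as a map onto [units] with the subspace topology, is a local
    homeomorphism; its continuity is part of the topological groupoid axioms. *)
Definition etale : Prop := forall x : G, exists U : set G,
  [/\ open U, U x, set_inj U grng
    & forall W : set G, open W -> W `<=` U ->
        exists2 V : set G, open V & grng @` W = V `&` units].

Record subgroupoid := Subgroupoid {
  sgset :> set G;
  sg_mul : forall x y, sgset x -> sgset y -> composable x y ->
    sgset (gmul x y);
  sg_inv : forall x, sgset x -> sgset (ginv x) }.

Lemma grngM (x y : G) : composable x y -> grng (gmul x y) = grng x.
Proof. exact: (groupoid_rM (g_groupoid G)). Qed.

Lemma gsrcM (x y : G) : composable x y -> gsrc (gmul x y) = gsrc y.
Proof. exact: (groupoid_sM (g_groupoid G)). Qed.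

Lemma ginvK (x : G) : ginv (ginv x) = x.
Proof. exact: (groupoid_invK (g_groupoid G)). Qed.

Lemma grngV (x : G) : grng (ginv x) = gsrc x.
Proof. by rewrite /grng /gsrc ginvK. Qed.

Lemma gsrcV (x : G) : gsrc (ginv x) = grng x.
Proof. by rewrite /grng /gsrc ginvK. Qed.

Lemma composable_V (x : G) : composable x (ginv x).
Proof. by rewrite /composable grngV. Qed.

Lemma composableV_ (x : G) : composable (ginv x) x.
Proof. by rewrite /composable gsrcV. Qed.

Lemma composable_units (x : G) : units x -> composable x x.
Proof.
case=> y _ <-; have cyV := composable_V y.
have sr : gsrc (grng y) = grng y := etrans (gsrcM cyV) (gsrcV y).
exact: etrans sr (esym (grngM cyV)).
Qed.

Lemma units_src (x : G) : units (gsrc x).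
Proof. by exists (ginv x) => //; exact: grngV. Qed.

Definition reduction (Z : set G) : subgroupoid.
Proof.
refine (@Subgroupoid [set x | Z (grng x) /\ Z (gsrc x)] _ _).
- by move=> x y [? _] [_ ?] cxy; split; rewrite ?grngM ?gsrcM.
- by move=> x [? ?]; split; rewrite ?grngV ?gsrcV.
Defined.

End GroupoidTheory.

Arguments etale G : clear implicits.
Arguments subgroupoid G : clear implicits.

Lemma set_type_in (T : Type) (K : set T) (x : K) : K (set_val x).
Proof. by rewrite set_valE; apply/set_mem; case: x. Qed.

Section SubspaceTopology.
Variable X : topologicalType.

Lemma set_val_continuous (K : set X) : continuous (set_val : K -> X).
Proof. exact: initial_continuous. Qed.

Lemma set_type_continuous (Y : topologicalType) (K : set X) (f : Y -> K) :
  continuous (fun y => set_val (f y)) -> continuous f.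
Proof. exact: continuous_comp_initial. Qed.

Lemma set_type_cvg (K : set X) (F : set_system K) (x : K) :
  Filter F -> set_val @ F --> set_val x -> F --> x.
Proof.
move=> FF cF A; rewrite nbhsE /= => -[B [[W oW <-] Wx] BA].
apply: filterS BA _; apply: (cF W).
exact: open_nbhs_nbhs.
Qed.

Lemma within_set_type_continuous (Y Y' : topologicalType) (K : set X)
    (u : Y' -> Y) (f : Y -> X) (f' : Y' -> K) (D : set Y) (D' : set Y') :
  continuous u -> (forall y, D' y -> D (u y)) ->
  (forall y, D' y -> set_val (f' y) = f (u y)) ->
  {within D, continuous f} -> {within D', continuous f'}.
Proof.
move=> cu uD vf /subspace_continuousP cf; apply/subspace_continuousP => y D'y.
apply: set_type_cvg => W; rewrite vf// => /(cf _ (uD _ D'y)) /cu.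
rewrite /within /= !nbhs_simpl /=; apply: filterS => z Wz D'z.
by rewrite /= vf//; exact: (Wz (uD _ D'z)).
Qed.

Lemma comp_continuous (Y Z W : topologicalType) (f : Y -> Z) (g : Z -> W) :
  continuous f -> continuous g -> continuous (fun x => g (f x)).
Proof. by move=> cf cg x; exact: (continuous_comp (cf x) (cg (f x))). Qed.

Lemma pair_continuous (Y Z Y' Z' : topologicalType) (u : Y' -> Y)
    (v : Z' -> Z) :
  continuous u -> continuous v ->
  continuous (fun yz : Y' * Z' => (u yz.1, v yz.2)).
Proof.
move=> cu cv x; apply: (@cvg_pair _ _ _ _ (nbhs (u x.1)) (nbhs (v x.2))).
  by apply: (@cvg_comp _ _ _ fst u _ (nbhs x.1)); [exact: cvg_fst|exact: cu].
by apply: (@cvg_comp _ _ _ snd v _ (nbhs x.2)); [exact: cvg_snd|exact: cv].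
Qed.

End SubspaceTopology.

Section SubGroupoid.
Variables (G : topGroupoid) (K : subgroupoid G).

Definition sub_gmul (x y : K) : K :=
  insubd x (gmul (set_val x) (set_val y)).

Definition sub_ginv (x : K) : K :=
  exist _ (ginv (set_val x)) (mem_set (sg_inv (set_type_in x))).

Lemma set_val_inv (x : K) : set_val (sub_ginv x) = ginv (set_val x).
Proof. by []. Qed.

Lemma set_val_mul (x y : K) : composable (set_val x) (set_val y) ->
  set_val (sub_gmul x y) = gmul (set_val x) (set_val y).
Proof.
move=> cxy; rewrite /sub_gmul set_valE val_insubd.
rewrite mem_set//; exact: sg_mul (set_type_in x) (set_type_in y) cxy.
Qed.

Lemma set_val_rng (x : K) :
  set_val (sub_gmul x (sub_ginv x)) = grng (set_val x).
Proof. by rewrite set_val_mul// set_val_inv; apply: composable_V. Qed.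

Lemma set_val_src (x : K) :
  set_val (sub_gmul (sub_ginv x) x) = gsrc (set_val x).
Proof. by rewrite set_val_mul// set_val_inv; apply: composableV_. Qed.

Lemma sub_composable (x y : K) :
  sub_gmul (sub_ginv x) x = sub_gmul y (sub_ginv y) ->
  composable (set_val x) (set_val y).
Proof. by move=> /(congr1 set_val); rewrite set_val_rng set_val_src. Qed.

Lemma set_val_inj_sub : injective (set_val : K -> G).
Proof. by rewrite set_valE; exact: val_inj. Qed.

Lemma sub_is_groupoid : is_groupoid sub_gmul sub_ginv.
Proof.
have gG := g_groupoid G.
split.
- by move=> x; apply: set_val_inj_sub; rewrite !set_val_inv ginvK.
- move=> x y /sub_composable cxy; apply: set_val_inj_sub.
  by rewrite !set_val_rng set_val_mul// grngM.
- move=> x y /sub_composable cxy; apply: set_val_inj_sub.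
  by rewrite !set_val_src set_val_mul// gsrcM.
- move=> x y z /sub_composable cxy /sub_composable cyz; apply: set_val_inj_sub.
  have cx_yz : composable (set_val x) (set_val (sub_gmul y z)).
    by rewrite /composable set_val_mul// grngM.
  have cxy_z : composable (set_val (sub_gmul x y)) (set_val z).
    by rewrite /composable set_val_mul// gsrcM.
  rewrite (set_val_mul cx_yz) (set_val_mul cyz).
  rewrite (set_val_mul cxy_z) (set_val_mul cxy).
  exact: (groupoid_mulA gG cxy cyz).
- move=> x; apply: set_val_inj_sub.
  have e : gmul (grng (set_val x)) (set_val x) = set_val x.
    exact: (groupoid_mul_r gG).
  rewrite set_val_mul set_val_rng// /composable /grng.
  by rewrite -/(grng (set_val x)) gsrcM ?gsrcV//; exact: composable_V.
- move=> x; apply: set_val_inj_sub.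
  have e : gmul (set_val x) (gsrc (set_val x)) = set_val x.
    exact: (groupoid_mul_s gG).
  rewrite set_val_mul set_val_src// /composable {2}/gsrc.
  by rewrite grngM ?grngV//; exact: composableV_.
Qed.

Lemma sub_gmul_continuous :
  {within [set xy : K * K |
             sub_gmul (sub_ginv xy.1) xy.1 = sub_gmul xy.2 (sub_ginv xy.2)],
     continuous (fun xy : K * K => sub_gmul xy.1 xy.2)}.
Proof.
apply: (within_set_type_continuous
  (pair_continuous (@set_val_continuous G K) (@set_val_continuous G K))
  _ _ (@g_mul_continuous G)) => -[x y] /sub_composable cxy //=.
exact: set_val_mul.
Qed.

Lemma sub_ginv_continuous : continuous sub_ginv.
Proof.
apply: set_type_continuous.
exact: (comp_continuous (@set_val_continuous G K) (@g_inv_continuous G)).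
Qed.

Definition sub_groupoid : topGroupoid :=
  TopGroupoid sub_is_groupoid sub_gmul_continuous sub_ginv_continuous.

End SubGroupoid.

(** The library norm on a complex normed space takes its (nonnegative real)
    values in [R[i]]; [rnorm] is the same norm seen in [R]. *)
Section OperatorAlgebras.
Variable R : realType.
Implicit Types V : completeNormedModType R[i].

Definition rnorm (V : normedModType R[i]) (v : V) : R := complex.Re `|v|.

Definition dense_span V (S : set V) : Prop :=
  closure [set v : V | exists n (k : 'I_n -> R[i]) (u : 'I_n -> V),
             (forall i, S (u i)) /\ v = \sum_(i < n) k i *: u i] = setT.

Record is_bilinear (U V W : completeNormedModType R[i]) (m : U -> V -> W)
    : Prop := IsBilinear {
  bilinear_l : forall (k : R[i]) a b c, m (k *: a + b) c = k *: m a c + m b c;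
  bilinear_r : forall (k : R[i]) a b c, m a (k *: b + c) = k *: m a b + m a c }.

Definition conj_linear (U V : completeNormedModType R[i]) (st : U -> V)
    : Prop :=
  forall (k : R[i]) a b, st (k *: a + b) = k^*%C *: st a + st b.

Record is_cstar V (m : V -> V -> V) (st : V -> V) : Prop := IsCstar {
  cstar_bilinear : is_bilinear m;
  cstar_mulA : forall a b c, m a (m b c) = m (m a b) c;
  cstar_conj_linear : conj_linear st;
  cstar_starK : forall a, st (st a) = a;
  cstar_starM : forall a b, st (m a b) = m (st b) (st a);
  cstar_normM : forall a b, `|m a b| <= `|a| * `|b|;
  cstar_identity : forall a, `|m (st a) a| = `|a| ^+ 2 }.

Record cstarAlgebra := CstarAlgebra {
  cs_car :> completeNormedModType R[i];
  cs_mul : cs_car -> cs_car -> cs_car;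
  cs_star : cs_car -> cs_car;
  cs_axioms : is_cstar cs_mul cs_star }.

(** [lip] and [rip] are the [A]- and [B]-valued inner products. The norm that
    each of them induces is required to be the given complete norm of [X]; in
    particular both are definite. *)
Record is_imprimitivity_bimodule (A B X : completeNormedModType R[i])
    (mA : A -> A -> A) (stA : A -> A) (mB : B -> B -> B) (stB : B -> B)
    (la : A -> X -> X) (ra : X -> B -> X)
    (lip : X -> X -> A) (rip : X -> X -> B) : Prop := IsImprimitivityBimodule {
  imp_la_bilinear : is_bilinear la;
  imp_laM : forall a b x, la (mA a b) x = la a (la b x);
  imp_ra_bilinear : is_bilinear ra;
  imp_raM : forall x a b, ra x (mB a b) = ra (ra x a) b;
  imp_la_ra : forall a x b, la a (ra x b) = ra (la a x) b;
  imp_lip_linear : forall y (k : R[i]) x x',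
    lip (k *: x + x') y = k *: lip x y + lip x' y;
  imp_lip_la : forall a x y, lip (la a x) y = mA a (lip x y);
  imp_lip_star : forall x y, stA (lip x y) = lip y x;
  imp_lip_ge0 : forall x, exists a, lip x x = mA (stA a) a;
  imp_lip_norm : forall x, `|lip x x| = `|x| ^+ 2;
  imp_lip_full : dense_span [set a | exists x y, a = lip x y];
  imp_rip_linear : forall x (k : R[i]) y y',
    rip x (k *: y + y') = k *: rip x y + rip x y';
  imp_rip_ra : forall x y b, rip x (ra y b) = mB (rip x y) b;
  imp_rip_star : forall x y, stB (rip x y) = rip y x;
  imp_rip_ge0 : forall x, exists b, rip x x = mB (stB b) b;
  imp_rip_norm : forall x, `|rip x x| = `|x| ^+ 2;
  imp_rip_full : dense_span [set b | exists x y, b = rip x y];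
  imp_la_adjoint : forall a x y, rip (la a x) y = rip x (la (stA a) y);
  imp_ra_adjoint : forall b x y, lip (ra x b) y = lip x (ra y (stB b));
  imp_compat : forall x y z, la (lip x y) z = ra x (rip y z) }.

Record hilbertSpace := HilbertSpace {
  h_car :> completeNormedModType R[i];
  h_ip : h_car -> h_car -> R[i];
  h_ip_linear : forall (k : R[i]) u v w,
    h_ip (k *: u + v) w = k * h_ip u w + h_ip v w;
  h_ip_conj : forall u v, h_ip v u = (h_ip u v)^*%C;
  h_ip_norm : forall v, h_ip v v = `|v| ^+ 2 }.

Definition bounded_op (H : hilbertSpace) (T : H -> H) : Prop :=
  linear T /\ exists M : R, forall v, rnorm (T v) <= M * rnorm v.

Definition opnorm (H : hilbertSpace) (T : H -> H) : R :=
  sup [set rnorm (T v) | v in [set v : H | rnorm v <= 1]].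

End OperatorAlgebras.

(** A family of complex Banach spaces [fib x] indexed by [X], together with a
    total space [tot]; [inc x] identifies [fib x] with the fibre of [tproj]
    over [x].  *)
Record banachFamily (R : realType) (X : topologicalType) := BanachFamily {
  tot : topologicalType;
  tproj : tot -> X;
  fib : X -> completeNormedModType R[i];
  inc : forall x, fib x -> tot;
  inc_inj : forall x, injective (@inc x);
  tproj_inc : forall x (a : fib x), tproj (inc a) = x;
  inc_surj : forall e, exists a : fib (tproj e), inc a = e }.

Section BanachBundles.
Variables (R : realType) (X : topologicalType) (E : banachFamily R X).

(** The element of [fib x] corresponding to [e], when [tproj e = x]. *)
Definition at_fib (x : X) (e : tot E) : fib E x :=
  xget 0 [set a | inc a = e].

Lemma inc_at_fib (x : X) (e : tot E) : tproj e = x -> inc (at_fib x e) = e.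
Proof.
move=> <-; rewrite /at_fib; case: xgetP => // h.
by have [a ae] := inc_surj e; case: (h a).
Qed.

Lemma at_fib_inc (x : X) (a : fib E x) : at_fib x (inc a) = a.
Proof. by apply: (@inc_inj _ _ E); apply: inc_at_fib; rewrite tproj_inc. Qed.

Definition tnorm (e : tot E) : R := rnorm (at_fib (tproj e) e).

Definition tadd (e f : tot E) : tot E :=
  inc (at_fib (tproj e) e + at_fib (tproj e) f).

Definition tscale (k : R[i]^o) (e : tot E) : tot E :=
  inc ((k : R[i]) *: at_fib (tproj e) e).

(** The nets of the last axiom are represented by proper filters on the total
    space. *)
Record is_usc_banach_bundle : Prop := IsUscBanachBundle {
  tproj_continuous : continuous (@tproj _ _ E);
  tproj_open : forall U, open U -> open (@tproj _ _ E @` U);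
  tproj_surj : range (@tproj _ _ E) = setT;
  norm_usc : forall t : R, open [set e | tnorm e < t];
  tadd_continuous : {within [set ef : tot E * tot E | tproj ef.1 = tproj ef.2],
    continuous (fun ef : tot E * tot E => tadd ef.1 ef.2)};
  tscale_continuous :
    continuous (fun ke : R[i]^o * tot E => tscale ke.1 ke.2);
  zero_limit : forall (F : set_system (tot E)) (x : X), ProperFilter F ->
    tnorm @ F --> (0 : R) -> @tproj _ _ E @ F --> x ->
    F --> inc (0 : fib E x) }.

End BanachBundles.

Section FellAxioms.
Variables (R : realType) (G : topGroupoid) (E : banachFamily R G).
Variables (mul : tot E -> tot E -> tot E) (star : tot E -> tot E).

(** Products and adjoints of fibre elements, as elements of [fib E z]; they are
    only used when [z] is the arrow over which the product or adjoint lies. *)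
Definition fibmul (x y z : G) (a : fib E x) (b : fib E y) : fib E z :=
  at_fib z (mul (inc a) (inc b)).
Definition fibstar (x z : G) (a : fib E x) : fib E z :=
  at_fib z (star (inc a)).

Definition tcomposable (a b : tot E) : Prop := composable (tproj a) (tproj b).

Record is_fell_bundle : Prop := IsFellBundle {
  fell_bundle : is_usc_banach_bundle E;
  fell_proj_mul : forall a b, tcomposable a b ->
    tproj (mul a b) = gmul (tproj a) (tproj b);
  fell_proj_star : forall a, tproj (star a) = ginv (tproj a);
  fell_mul_continuous :
    {within [set ab : tot E * tot E | tcomposable ab.1 ab.2],
      continuous (fun ab : tot E * tot E => mul ab.1 ab.2)};
  fell_star_continuous : continuous star;
  fell_mul_bilinear : forall x y, composable x y ->
    is_bilinear (@fibmul x y (gmul x y));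
  fell_mulA : forall a b c, tcomposable a b -> tcomposable b c ->
    mul a (mul b c) = mul (mul a b) c;
  fell_star_conj_linear : forall x, conj_linear (@fibstar x (ginv x));
  fell_starK : forall a, star (star a) = a;
  fell_starM : forall a b, tcomposable a b ->
    star (mul a b) = mul (star b) (star a);
  fell_cstar : forall x, units x -> is_cstar (@fibmul x x x) (@fibstar x x);
  fell_imprimitivity : forall x,
    is_imprimitivity_bimodule
      (@fibmul (grng x) (grng x) (grng x)) (@fibstar (grng x) (grng x))
      (@fibmul (gsrc x) (gsrc x) (gsrc x)) (@fibstar (gsrc x) (gsrc x))
      (@fibmul (grng x) x x) (@fibmul x (gsrc x) x)
      (fun a b : fib E x =>
         fibmul (grng x) a (fibstar (ginv x) b))
      (fun a b : fib E x =>
         fibmul (gsrc x) (fibstar (ginv x) a) b);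
  fell_saturated : forall x y, composable x y ->
    dense_span [set c | exists (a : fib E x) (b : fib E y),
                          c = fibmul (gmul x y) a b] }.

End FellAxioms.

Record fellBundle (R : realType) (G : topGroupoid) := FellBundle {
  fb_family :> banachFamily R G;
  fb_mul : tot fb_family -> tot fb_family -> tot fb_family;
  fb_star : tot fb_family -> tot fb_family;
  fb_axioms : is_fell_bundle fb_mul fb_star }.

Section Restriction.
Variables (R : realType) (G : topGroupoid) (A : fellBundle R G).
Variable K : subgroupoid G.
Let GK := sub_groupoid K.
Let totK : set (tot A) := @tproj _ _ A @^-1` K.

Definition res_proj (e : totK) : GK :=
  exist _ (tproj (set_val e)) (mem_set (set_type_in e)).

Lemma res_inc_subproof (x : GK) (a : fib A (set_val x)) : totK (inc a).
Proof. by rewrite /totK /= tproj_inc; exact: set_type_in. Qed.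

Definition res_inc (x : GK) (a : fib A (set_val x)) : totK :=
  exist _ (inc a) (mem_set (res_inc_subproof a)).

Lemma set_val_injT (e f : totK) : set_val e = set_val f -> e = f.
Proof. by rewrite set_valE; exact: val_inj. Qed.

Lemma res_inc_inj (x : GK) : injective (@res_inc x).
Proof. by move=> a b /(congr1 set_val); exact: inc_inj. Qed.

Lemma res_proj_inc (x : GK) (a : fib A (set_val x)) : res_proj (res_inc a) = x.
Proof. by apply: set_val_inj_sub; exact: tproj_inc. Qed.

Lemma res_inc_surj (e : totK) :
  exists a : fib A (set_val (res_proj e)), res_inc a = e.
Proof.
have [a ae] := inc_surj (set_val e); exists a.
exact: set_val_injT.
Qed.

Definition res_family : banachFamily R GK :=
  BanachFamily res_inc_inj res_proj_inc res_inc_surj.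

Definition res_mul (e f : totK) : totK :=
  insubd e (fb_mul (set_val e) (set_val f)).

Lemma res_star_subproof (e : totK) : totK (fb_star (set_val e)).
Proof.
rewrite /totK /= (fell_proj_star (fb_axioms A)); apply: sg_inv.
exact: set_type_in e.
Qed.

Definition res_star (e : totK) : totK :=
  exist _ (fb_star (set_val e)) (mem_set (res_star_subproof e)).

Lemma at_fib_res (x : GK) (e : totK) :
  at_fib (E := res_family) x e = at_fib (E := A) (set_val x) (set_val e).
Proof.
rewrite /at_fib; congr xget; apply/seteqP; split=> a /=.
  by move=> <-.
by move=> ae; apply: set_val_injT.
Qed.

Lemma tcomposable_res (e f : totK) :
  tcomposable (E := res_family) e f -> tcomposable (set_val e) (set_val f).
Proof. exact: sub_composable. Qed.

Lemma set_val_res_mul (e f : totK) :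
  tcomposable (set_val e) (set_val f) ->
  set_val (res_mul e f) = fb_mul (set_val e) (set_val f).
Proof.
move=> cef; rewrite /res_mul set_valE val_insubd -set_valE mem_set//.
rewrite /totK /= (fell_proj_mul (fb_axioms A))//.
exact: sg_mul (set_type_in e) (set_type_in f) cef.
Qed.

Lemma res_usc_banach_bundle : is_usc_banach_bundle res_family.
Proof.
have usc := fell_bundle (fb_axioms A).
have cval := @set_val_continuous (tot A) totK.
split.
- apply: set_type_continuous.
  exact: (comp_continuous cval (tproj_continuous usc)).
- move=> _ [V oV <-]; exists (@tproj _ _ A @` V); first exact: (tproj_open usc).
  apply/seteqP; split=> [x /= [e Ve ex]|x /= [e Ve <-]]; last first.
    by exists (set_val e).
  have tKe : totK e by rewrite /totK /= ex; exact: set_type_in.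
  exists (exist _ e (mem_set tKe)) => //.
  exact: set_val_inj_sub.
- apply/seteqP; split=> // x _.
  by exists (res_inc (0 : fib A (set_val x))) => //; exact: res_proj_inc.
- move=> t; exists [set e | tnorm e < t]; first exact: (norm_usc usc).
  by apply/seteqP; split=> e /=; rewrite /tnorm at_fib_res.
- apply: (within_set_type_continuous (pair_continuous cval cval) _ _
    (tadd_continuous usc)) => -[e f] /=.
    by move=> /(congr1 set_val).
  by move=> _; rewrite /tadd /= !at_fib_res.
- apply: set_type_continuous.
  have -> : (fun ke : R[i]^o * totK =>
      set_val (tscale (E := res_family) ke.1 ke.2)) =
      (fun ke : R[i]^o * tot A => tscale ke.1 ke.2) \o
      (fun ke : R[i]^o * totK => (ke.1, set_val ke.2)).
    by apply/funext => -[l f] /=; rewrite /tscale /= at_fib_res.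
  apply: (comp_continuous _ (tscale_continuous usc)).
  exact: (pair_continuous (u := idfun) (fun x => cvg_id) cval).
- move=> F x FF nF pF; apply: set_type_cvg.
  have tn : tnorm (E := res_family) = (fun e => tnorm (set_val e)).
    by apply/funext => e; rewrite /tnorm at_fib_res.
  rewrite tn in nF.
  have PF : ProperFilter (set_val @ F) by exact: fmap_proper_filter.
  apply: (@zero_limit _ _ _ usc (set_val @ F) (set_val x) PF nF).
  exact: (cvg_comp _ _ pF (@set_val_continuous G K x)).
Qed.

Lemma fibmul_res (x y z : GK) : composable x y ->
  @fibmul R GK res_family res_mul x y z =
  @fibmul R G A (@fb_mul _ _ A) (set_val x) (set_val y) (set_val z).
Proof.
move=> cxy; apply/funext => a; apply/funext => b.
rewrite /fibmul at_fib_res set_val_res_mul//.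
by rewrite /tcomposable !tproj_inc; exact: sub_composable.
Qed.

Lemma fibstar_res (x z : GK) :
  @fibstar R GK res_family res_star x z =
  @fibstar R G A (@fb_star _ _ A) (set_val x) (set_val z).
Proof. by apply/funext => a; rewrite /fibstar at_fib_res. Qed.

Lemma sub_grng (x : GK) : set_val (grng x) = grng (set_val x).
Proof. exact: set_val_rng. Qed.

Lemma sub_gsrc (x : GK) : set_val (gsrc x) = gsrc (set_val x).
Proof. exact: set_val_src. Qed.

Lemma res_is_fell_bundle : is_fell_bundle (E := res_family) res_mul res_star.
Proof.
have ax := fb_axioms A.
have cval := @set_val_continuous (tot A) totK.
split.
- exact: res_usc_banach_bundle.
- move=> a b cab; apply: set_val_inj_sub; have cab' := tcomposable_res cab.
  rewrite set_val_mul//= -(fell_proj_mul ax)//.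
  by congr tproj; exact: set_val_res_mul.
- by move=> a; apply: set_val_inj_sub; exact: (fell_proj_star ax).
- apply: (within_set_type_continuous (pair_continuous cval cval) _ _
    (fell_mul_continuous ax)) => -[e f] /= /tcomposable_res cef //.
  exact: set_val_res_mul.
- apply: set_type_continuous.
  exact: (comp_continuous cval (fell_star_continuous ax)).
- move=> x y cxy; rewrite fibmul_res//.
  have cxy' := sub_composable cxy.
  have key (z : G) : z = gmul (set_val x) (set_val y) ->
      is_bilinear (@fibmul R G A (@fb_mul _ _ A) (set_val x) (set_val y) z).
    by move=> ->; exact: (fell_mul_bilinear ax).
  exact: key (set_val_mul cxy').
- move=> a b c cab cbc; apply: set_val_injT.
  have cab' := tcomposable_res cab; have cbc' := tcomposable_res cbc.
  have ca_bc : tcomposable (set_val a) (set_val (res_mul b c)).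
    rewrite set_val_res_mul// /tcomposable (fell_proj_mul ax)//.
    by rewrite /composable grngM.
  have cab_c : tcomposable (set_val (res_mul a b)) (set_val c).
    rewrite set_val_res_mul// /tcomposable (fell_proj_mul ax)//.
    by rewrite /composable gsrcM.
  rewrite (set_val_res_mul ca_bc) (set_val_res_mul cbc').
  rewrite (set_val_res_mul cab_c) (set_val_res_mul cab').
  exact: (fell_mulA ax).
- by move=> x; rewrite fibstar_res; exact: (fell_star_conj_linear ax).
- by move=> a; apply: set_val_injT; exact: (fell_starK ax).
- move=> a b cab; apply: set_val_injT; have cab' := tcomposable_res cab.
  have cba : tcomposable (set_val (res_star b)) (set_val (res_star a)).
    rewrite /tcomposable /composable !(fell_proj_star ax) gsrcV grngV.
    exact: esym.
  rewrite (set_val_res_mul cba) /= -(fell_starM ax)//.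
  by congr fb_star; exact: set_val_res_mul.
- move=> x ux; have cxx := composable_units ux.
  rewrite fibmul_res// fibstar_res; apply: (fell_cstar ax).
  by case: ux => y _ <-; rewrite sub_grng; exists (set_val y).
- move=> x.
  have crr : composable (grng x) (grng x).
    by apply: composable_units; exact: imageT.
  have css : composable (gsrc x) (gsrc x).
    by apply: composable_units; exact: units_src.
  have crx : composable (grng x) x.
    by rewrite /composable (gsrcM (composable_V x)) gsrcV.
  have cxs : composable x (gsrc x).
    by rewrite /composable (grngM (composableV_ x)) grngV.
  have cxV := composable_V x; have cVx := composableV_ x.
  rewrite !fibmul_res// !fibstar_res.
  have key (u v w : G) : u = grng (set_val x) -> v = gsrc (set_val x) ->
      w = ginv (set_val x) ->
      is_imprimitivity_bimodule
        (@fibmul R G A (@fb_mul _ _ A) u u u)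
        (@fibstar R G A (@fb_star _ _ A) u u)
        (@fibmul R G A (@fb_mul _ _ A) v v v)
        (@fibstar R G A (@fb_star _ _ A) v v)
        (@fibmul R G A (@fb_mul _ _ A) u (set_val x) (set_val x))
        (@fibmul R G A (@fb_mul _ _ A) (set_val x) v (set_val x))
        (fun a b => @fibmul R G A (@fb_mul _ _ A) (set_val x) w u a
           (@fibstar R G A (@fb_star _ _ A) (set_val x) w b))
        (fun a b => @fibmul R G A (@fb_mul _ _ A) w (set_val x) v
           (@fibstar R G A (@fb_star _ _ A) (set_val x) w a) b).
    by move=> -> -> ->; exact: (fell_imprimitivity ax).
  exact: key (sub_grng x) (sub_gsrc x) (set_val_inv x).
- move=> x y cxy; have cxy' := sub_composable cxy.
  have -> : [set c | exists (a : fib res_family x) (b : fib res_family y),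
                c = fibmul (E := res_family) res_mul (gmul x y) a b] =
            [set c | exists (a : fib A (set_val x)) (b : fib A (set_val y)),
                c = fibmul (@fb_mul _ _ A) (set_val (gmul x y)) a b].
    by apply/seteqP; split=> _ [a [b ->]]; exists a, b; rewrite fibmul_res.
  have key (z : G) : z = gmul (set_val x) (set_val y) ->
      dense_span [set c | exists (a : fib A (set_val x))
                                 (b : fib A (set_val y)),
                            c = fibmul (@fb_mul _ _ A) z a b].
    by move=> ->; exact: (fell_saturated ax).
  exact: key (set_val_mul cxy').
Qed.

Definition restriction : fellBundle R GK := FellBundle res_is_fell_bundle.

End Restriction.

Section FullCstar.
Variables (R : realType) (G : topGroupoid) (A : fellBundle R G).

Definition bsection : Type := forall x : G, fib A x.
Implicit Types f g : bsection.

Definition Cc : set bsection :=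
  [set f | continuous (fun x => inc (f x)) /\
           compact (closure [set x | f x != 0])].

Definition sec_add f g : bsection := fun x => f x + g x.
Definition sec_scale (k : R[i]) f : bsection := fun x => k *: f x.

(** For [f], [g] in [Cc] over an étale groupoid, all but finitely many terms of
    the sum vanish. *)
Definition sec_conv f g : bsection := fun x =>
  \sum_(ab \in [set ab : G * G | composable ab.1 ab.2 /\ gmul ab.1 ab.2 = x])
     fibmul (@fb_mul _ _ A) x (f ab.1) (g ab.2).

Definition sec_star f : bsection := fun x =>
  fibstar (@fb_star _ _ A) x (f (ginv x)).

Definition Inorm f : \bar R :=
  maxe
    (ereal_sup [set (\esum_(x in [set x | grng x = u]) (rnorm (f x))%:E)%E
                 | u in @units G])
    (ereal_sup [set (\esum_(x in [set x | gsrc x = u]) (rnorm (f x))%:E)%E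
                 | u in @units G]).

(** Only the values of a representation on [Cc] are constrained. *)
Record is_representation (H : hilbertSpace R) (pi : bsection -> H -> H)
    : Prop := IsRepresentation {
  rep_bounded : forall f, Cc f -> bounded_op (pi f);
  rep_linear : forall k f g v, Cc f -> Cc g ->
    pi (sec_add (sec_scale k f) g) v = k *: pi f v + pi g v;
  rep_mul : forall f g v, Cc f -> Cc g ->
    pi (sec_conv f g) v = pi f (pi g v);
  rep_star : forall f v w, Cc f ->
    h_ip (pi f v) w = h_ip v (pi (sec_star f) w) }.

Definition I_bounded (H : hilbertSpace R) (pi : bsection -> H -> H) : Prop :=
  forall f, Cc f -> ((opnorm (pi f))%:E <= Inorm f)%E.

Definition full_norm f : R :=
  sup [set t | exists (H : hilbertSpace R) (pi : bsection -> H -> H),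
         [/\ is_representation pi, I_bounded pi & t = opnorm (pi f)]].

(** [B], together with the canonical map [iota] of [Cc] into it, is the
    completion of [Cc] for [full_norm]. The values of [iota] outside [Cc] are
    irrelevant. *)
Record is_full_cstar_algebra (B : cstarAlgebra R) (iota : bsection -> B)
    : Prop := IsFullCstarAlgebra {
  full_linear : forall k f g, Cc f -> Cc g ->
    iota (sec_add (sec_scale k f) g) = k *: iota f + iota g;
  full_mul : forall f g, Cc f -> Cc g ->
    iota (sec_conv f g) = cs_mul (iota f) (iota g);
  full_star : forall f, Cc f -> iota (sec_star f) = cs_star (iota f);
  full_isometric : forall f, Cc f -> rnorm (iota f) = full_norm f;
  full_dense : closure (iota @` Cc) = setT }.

End FullCstar.

Definition sec_restrict (R : realType) (G : topGroupoid) (A : fellBundle R G)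
    (K : subgroupoid G) (f : bsection A) : bsection (restriction A K) :=
  fun x => f (set_val x).

Record cocycle (R : realType) (G : topGroupoid) := Cocycle {
  coc :> G -> R;
  coc_continuous : continuous coc;
  cocM : forall x y, composable x y -> coc (gmul x y) = coc x + coc y }.

Section Cocycles.
Variables (R : realType) (G : topGroupoid) (c : cocycle R G).

Definition boundary : set G :=
  [set x | units x /\ forall g, grng g = x -> c g <= 0].

Lemma cocV (x : G) : c (ginv x) = - c x.
Proof.
have c0 (y : G) : c (grng y) = 0.
  have yy : units (grng y) by exact: imageT.
  have := cocM c (composable_units yy).
  have -> : gmul (grng y) (grng y) = grng y.
    have ryy : grng (grng y) = grng y := grngM (composable_V y).
    by rewrite -{1}ryy; exact: (groupoid_mul_r (g_groupoid G)).
  by move/eqP; rewrite -subr_eq0 opprD addrA subrr sub0r oppr_eq0 => /eqP.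
have := cocM c (composable_V x); rewrite -/(grng x) c0 => /esym/eqP.
by rewrite addrC addr_eq0 => /eqP.
Qed.

Definition coc_kernel : subgroupoid G.
Proof.
refine (@Subgroupoid G [set x | c x = 0] _ _) => [x y /= x0 y0 cxy|x /= x0].
- by rewrite cocM// x0 y0 addr0.
- by rewrite cocV x0 oppr0.
Defined.

End Cocycles.

Section States.
Variables (R : realType) (B : cstarAlgebra R).
Implicit Types (sigma : R -> B -> B) (psi : B -> R[i]).

(** As [sup] is [0] on unbounded sets, the last condition includes the
    continuity of [psi]. *)
Definition is_state psi : Prop :=
  [/\ scalar psi, (forall b, 0 <= psi (cs_mul (cs_star b) b))
    & sup [set complex.Re `|psi b| | b in [set b : B | rnorm b <= 1]] = 1].

Definition is_tracial psi : Prop :=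
  forall a b, psi (cs_mul a b) = psi (cs_mul b a).

Record is_dynamics sigma : Prop := IsDynamics {
  dyn_linear : forall t, linear (sigma t);
  dyn_mul : forall t a b,
    sigma t (cs_mul a b) = cs_mul (sigma t a) (sigma t b);
  dyn_star : forall t a, sigma t (cs_star a) = cs_star (sigma t a);
  dyn_0 : forall a, sigma 0 a = a;
  dyn_add : forall s t a, sigma (s + t) a = sigma s (sigma t a);
  dyn_continuous : forall a, continuous (fun t : R => sigma t a) }.

(** [F] is the entire extension [z |-> sigma_z(b)], which is unique when it
    exists; [b] is analytic when there is such an [F]. *)
Definition is_entire_extension sigma (b : B) (F : R[i]^o -> B) : Prop :=
  (forall z, derivable F z 1) /\ (forall t : R, F t%:C = sigma t b).

Definition is_ground_state sigma psi : Prop :=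
  is_state psi /\
  forall a b F, is_entire_extension sigma b F ->
    exists M : R, forall z : R[i], 0 <= complex.Im z ->
      complex.Re `|psi (cs_mul a (F z))| <= M.

Definition is_KMS sigma (beta : R) psi : Prop :=
  is_state psi /\
  forall a b Fa Fb, is_entire_extension sigma a Fa ->
    is_entire_extension sigma b Fb ->
    psi (cs_mul a b) = psi (cs_mul b (Fa (0 +i* beta))).

(** The net is indexed by a directed set [(I, le)]; [tails] is the filter of its
    eventual sets. *)
Definition is_KMS_infty sigma psi : Prop :=
  is_state psi /\
  exists (I : Type) (le : I -> I -> Prop) (beta : I -> R)
         (net : I -> B -> R[i]),
    let tails := filter_from setT (fun i => [set j | le i j]) in
    [/\ [/\ inhabited I, (forall i, le i i),
            (forall i j k, le i j -> le j k -> le i k)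
          & (forall i j, exists k, le i k /\ le j k)],
        forall i, is_KMS sigma (beta i) (net i),
        beta @ tails --> +oo
      & forall b : B, (fun i => net i b : R[i]^o) @ tails --> (psi b : R[i]^o)].

End States.

Section CocycleDynamics.
Variables (R : realType) (G : topGroupoid) (A : fellBundle R G).
Variable c : cocycle R G.

Definition sec_dynamics (t : R) (f : bsection A) : bsection A :=
  fun x => (cos (t * c x) +i* sin (t * c x)) *: f x.

Definition is_cocycle_dynamics (B : cstarAlgebra R) (iota : bsection A -> B)
    (sigma : R -> B -> B) : Prop :=
  is_dynamics sigma /\
  forall t f, Cc f -> sigma t (iota f) = iota (sec_dynamics t f).

End CocycleDynamics.

(* Main.v *)
Require Import Defs.
From mathcomp Require Import all_boot all_order all_algebra complex.
From mathcomp Require Import all_classical all_reals all_analysis.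
From mathcomp Require Import lra ring.

(** Since [c^-1(0)] is étale it is clopen in [G]. Sections supported in it are
    fixed by the dynamics, so KMS states commute on them, and hence so does the
    limit [psi]. As the boundary is invariant under [c^-1(0)], restriction of
    such sections to [G(Z)], a closed subset of [c^-1(0)], is multiplicative,
    so that [psi(f * g) = phi(f| * g|)]. It remains to see that every compactly
    supported section over [G(Z)] extends to one over [G] supported in
    [c^-1(0)]. This is a Michael selection argument, valid for upper
    semicontinuous Banach bundles: sections that are continuous up to an error
    [e] are patched together by bump functions, without changing them on
    [G(Z)], and successive patchings with [e = 2^-n] converge uniformly. *)

Set Implicit Arguments.
Unset Strict Implicit.
Unset Printing Implicit Defensive.

Import Order.TTheory GRing.Theory Num.Theory numFieldNormedType.Exports.

Local Open Scope classical_set_scope.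
Local Open Scope ring_scope.
Local Open Scope complex_scope.

(** * Bump functions and compact neighbourhoods *)

Section CompactSupports.

(** Replaces finite subcovers: the library has those only for pointed spaces. *)
Lemma compact_ind (X : topologicalType) (A : set X) (P : set X -> Prop) :
  compact A -> P set0 -> (forall S T, S `<=` T -> P T -> P S) ->
  (forall S T, P S -> P T -> P (S `|` T)) ->
  (forall x, A x -> exists2 U, nbhs x U & P U) -> P A.
Proof.
move=> cA P0 Psub PU Ploc; apply: contrapT => nPA.
pose F : set_system X := [set S | P (A `\` S)].
have FF : ProperFilter F.
  apply: Build_ProperFilter_ex => [S FS|].
    apply: contrapT => /set0P /negP; rewrite negbK => /eqP S0.
    by apply: nPA; move: FS; rewrite /F /= S0 setD0.
  split=> [|S T FS FT|S T ST FS].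
  - by rewrite /F /= setDT.
  - by rewrite /F /= setDIr; exact: PU.
  - by apply: Psub FS => x [Ax nTx]; split=> // /ST.
have [|x [Ax clx]] := cA F FF; first by rewrite /F /= setDv.
have [U Ux PUU] := Ploc x Ax.
have [|y [nUy Uy]] := clx (~` U) U _ Ux; last exact: nUy Uy.
by rewrite /F /=; apply: Psub PUU => y [_ /contrapT].
Qed.

Variables (R : realType) (X : topologicalType).
Hypotheses (lcX : locally_compact [set: X]) (hX : hausdorff_space X).

Lemma bump_function (y : X) (U : set X) : nbhs y U -> exists l : X -> R,
  [/\ continuous l, (forall x, 0 <= l x <= 1),
     exists F, [/\ closed F, F `<=` U & forall x, ~ F x -> l x = 0]
   & nbhs y [set x | l x = 1]].
Proof.
move=> Uy; have [V [oV Vy] VU] : exists2 V, open_nbhs y V & V `<=` U.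
  by move: Uy; rewrite nbhsE.
have sep : uniform_separator [set y] (~` V).
  apply: (@locally_compact_completely_regular X R lcX hX).
    exact: open_closedC.
  by move=> /(_ Vy).
pose u : X -> R := Urysohn [set y] (~` V).
have cu : continuous u by exact: Urysohn_continuous.
have u0 : u y = 0 by apply: (Urysohn_sub0 sep); exists y.
have u1 x : ~ V x -> u x = 1 by move=> nVx; apply: (Urysohn_sub1 sep); exists x.
(* This is a piecewise linear function of [u]: it is [1] for [u <= 1/3], [2 - 3 * u] in between, and
   [0] for [u >= 2/3]. So it is locally constant at [y], and the closed set [u <= 2/3] inside [V]
   carries it. *)
exists (fun x => (`|2 - 3 * u x| - `|1 - 3 * u x| + 1) / 2); split.
- have ck k : continuous (fun x => `|k - 3 * u x|).
    move=> x; apply: (@cvg_norm _ _ _ _ _ (fun x => k - 3 * u x)).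
    by apply: cvgB; [exact: cvg_cst|apply: cvgM; [exact: cvg_cst|exact: cu]].
  move=> x; apply: cvgM; last exact: cvg_cst.
  by apply: cvgD; [apply: cvgB; exact: ck|exact: cvg_cst].
- move=> x.
  by case: (ger0P (2 - 3 * u x)); case: (ger0P (1 - 3 * u x)) => *; lra.
- exists (u @^-1` [set t | t <= 2 / 3]); split.
  + by apply: preimage_closed; [move=> x _; exact: cu|exact: closed_le].
  + move=> x /= ux; apply: VU; apply: contrapT => /u1 ux1.
    by move: ux; rewrite ux1; lra.
  + move=> x /negP; rewrite -ltNge => ux.
    by case: (ger0P (2 - 3 * u x)); case: (ger0P (1 - 3 * u x)) => *; lra.
- have /cu uy : nbhs (u y) [set t : R | t < 1 / 3].
    by rewrite u0; apply: open_nbhs_nbhs; split;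
      [exact: open_lt|rewrite /=; lra].
  apply: (@filterS _ (nbhs y) _ _ _ _ uy) => x /= ux.
  by case: (ger0P (2 - 3 * u x)); case: (ger0P (1 - 3 * u x)) => *; lra.
Qed.

(** Finitely many compact neighbourhoods cover [C]. Intersecting their union with [W] keeps it
    compact because [W] is closed, and keeps [C] in the interior because [W] is open. *)
Lemma compact_neighbourhood (C W : set X) : compact C -> clopen W -> C `<=` W ->
  exists D, [/\ compact D, D `<=` W & C `<=` D^°].
Proof.
move=> cC [oW cW] CW.
have : exists2 D, compact D & C `<=` D^°.
  apply: (compact_ind (P := fun S => exists2 D, compact D & S `<=` D^°) cC).
  - by exists set0; [exact: compact0|exact: sub0set].
  - by move=> S T ST [D cD TD]; exists D => //; exact: subset_trans TD.
  - move=> S T [D cD SD] [E cE TE]; exists (D `|` E); first exact: compactU.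
    move=> x [/SD|/TE]; apply: interiorS; [exact: subsetUl|exact: subsetUr].
  - move=> x _; have [D] := lcX (x:=x) I; rewrite withinET => Dx [cD _].
    exists D^°; last by exists D.
    by apply: open_nbhs_nbhs; split=> //; exact: open_interior.
case=> D cD CD; exists (D `&` W); split => //.
- exact: compact_closedI.
- move=> x Cx; rewrite interiorI; split; first exact: CD.
  by move/interior_id: oW => ->; exact: CW.
Qed.

End CompactSupports.

(** * The real-valued norm and its neighbourhoods *)

Section RealNorm.
Variables (R : realType) (V : normedModType R[i]).
Implicit Types (v w : V) (t : R).

(** Radii of balls live in [R[i]], whose order makes every positive element real. *)
Lemma gtc0_real (e : R[i]) : 0 < e -> exists2 t : R, 0 < t & e = t%:C.
Proof.
case: e => a b; rewrite ltcE => /andP[/eqP /= b0 a0].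
by exists a; [exact: a0|rewrite b0].
Qed.

Lemma normrE v : `|v| = (rnorm v)%:C.
Proof. by rewrite /rnorm RRe_real// ger0_real. Qed.

Lemma rnorm_ge0 v : 0 <= rnorm v.
Proof. by rewrite -lecR -normrE; exact: normr_ge0. Qed.

Lemma rnormD v w : rnorm (v + w) <= rnorm v + rnorm w.
Proof. by rewrite -lecR rmorphD /= -!normrE ler_normD. Qed.

Lemma rnorm0 : rnorm (0 : V) = 0.
Proof. by rewrite /rnorm normr0. Qed.

Lemma rnormN v : rnorm (- v) = rnorm v.
Proof. by rewrite /rnorm normrN. Qed.

Lemma rnormBC v w : rnorm (v - w) = rnorm (w - v).
Proof. by rewrite /rnorm distrC. Qed.

Lemma rnormZ t v : rnorm (t%:C *: v) = `|t| * rnorm v.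
Proof.
rewrite /rnorm normrZ normrE -[in RHS]/(rnorm v) normc_def /=.
by rewrite expr0n addr0 sqrtr_sqr mul0r subr0.
Qed.

Lemma rnormB_le v w u : rnorm (v - u) <= rnorm (v - w) + rnorm (w - u).
Proof. by rewrite -[v - u](subrKA w) rnormD. Qed.

Lemma nbhs_rnormP v (S : set V) : nbhs v S <->
  exists2 t, 0 < t & forall w, rnorm (w - v) < t -> S w.
Proof.
split=> [/nbhs_ballP[e /= /gtc0_real[t t0 ->] vS]|[t t0 vS]].
  exists t => // w wv; apply: vS; rewrite -ball_normE /= normrE ltcR.
  by rewrite rnormBC.
apply/nbhs_ballP; exists t%:C => /=; first by rewrite ltcR.
move=> w; rewrite -ball_normE /= normrE ltcR => vw; apply: vS.
by rewrite rnormBC.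
Qed.

End RealNorm.

Lemma rnorm_cauchy_cvg (R : realType) (V : completeNormedModType R[i])
    (u : nat -> V) :
  (forall t, 0 < t -> exists N, forall m, (N <= m)%N ->
     rnorm (u m - u N) < t) ->
  exists l : V, u @ \oo --> l.
Proof.
move=> cu; suff : cvg (u @ \oo) by move=> ?; exists (lim (u @ \oo)).
apply: cauchy_cvg; apply: cauchy_exP => e /gtc0_real[t t0 ->].
have [N uN] := cu t t0; exists (u N); exists N => // m /= Nm.
by rewrite -ball_normE /= normrE ltcR rnormBC uN.
Qed.

(** * Neighbourhoods in the total space of a Banach bundle *)

Section SectionExtension.
Variables (R : realType) (X : topologicalType) (E : banachFamily R X).
Hypothesis uscE : is_usc_banach_bundle E.
Implicit Types (x y z : X).

Lemma tnorm_inc x (a : fib E x) : tnorm (inc a) = rnorm a.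
Proof.
(* The type of [at_fib (tproj e) e] depends on [tproj e], so the equation on base points is used for
   a variable [e], where it can be substituted. *)
have key (e : tot E) : tproj e = x -> tnorm e = rnorm (at_fib x e) by move=> <-.
by rewrite (key _ (tproj_inc a)) at_fib_inc.
Qed.

Lemma tadd_inc x (a b : fib E x) : tadd (inc a) (inc b) = inc (a + b).
Proof.
have key (e f : tot E) : tproj e = x ->
  tadd e f = inc (at_fib x e + at_fib x f) by move=> <-.
by rewrite (key _ _ (tproj_inc a)) !at_fib_inc.
Qed.

Lemma tscale_inc (k : R[i]) x (a : fib E x) : tscale k (inc a) = inc (k *: a).
Proof.
have key (e : tot E) : tproj e = x -> tscale k e = inc (k *: at_fib x e)
  by move=> <-.
by rewrite (key _ (tproj_inc a)) at_fib_inc.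
Qed.

Lemma nbhs_proj x (a : fib E x) (V : set X) :
  nbhs x V -> nbhs (inc a) [set e | V (tproj e)].
Proof. by move=> Vx; apply: (tproj_continuous uscE); rewrite tproj_inc. Qed.

(** Openness of the projection supplies approximate local lifts of [a]; it stands in for continuous
    local sections. *)
Lemma nbhs_fib_ex x (a : fib E x) U : nbhs (inc a) U ->
  \forall z \near x, exists b : fib E z, U (inc b).
Proof.
move=> Ua; have : nbhs x (@tproj _ _ E @` U^°).
  apply: open_nbhs_nbhs; split; first exact/(tproj_open uscE)/open_interior.
  by exists (inc a); rewrite ?tproj_inc.
apply: filterS => _ [e /interior_subset Ue <-].
by have [b be] := inc_surj e; exists b; rewrite be.
Qed.

Lemma nbhs_rnorm x (a : fib E x) t : rnorm a < t ->
  nbhs (inc a) [set e | tnorm e < t].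
Proof.
move=> at_; apply: open_nbhs_nbhs; split; first exact: norm_usc.
by rewrite /= tnorm_inc.
Qed.

Lemma nbhs_incD x (a b : fib E x) W : nbhs (inc (a + b)) W ->
  exists U V, [/\ nbhs (inc a) U, nbhs (inc b) V
    & forall z (a' b' : fib E z),
        U (inc a') -> V (inc b') -> W (inc (a' + b'))].
Proof.
have /subspace_continuousP cadd := tadd_continuous uscE.
have ab : tproj (inc a) = tproj (inc b) by rewrite !tproj_inc.
rewrite -tadd_inc => /(cadd (inc a, inc b) ab)[[U V] [/= Ua Vb] UVW].
exists U, V; split=> // z a' b' Ua' Vb'.
rewrite -tadd_inc; apply: (UVW (inc a', inc b')) => //=.
by rewrite !tproj_inc.
Qed.

Lemma nbhs_incZ (k : R[i]^o) x (a : fib E x) W :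
  nbhs (inc ((k : R[i]) *: a)) W ->
  exists U V, [/\ nbhs k U, nbhs (inc a) V
    & forall (l : R[i]^o) z (a' : fib E z),
        U l -> V (inc a') -> W (inc ((l : R[i]) *: a'))].
Proof.
rewrite -tscale_inc => /(@tscale_continuous _ _ _ uscE (k, inc a)).
move=> [[U V] [/= Uk Va] UVW].
exists U, V; split=> // l z a' Ul Va'.
by rewrite -tscale_inc; exact: (UVW (l, inc a')).
Qed.

Lemma nbhs_incB x (a b : fib E x) W : nbhs (inc (a - b)) W ->
  exists U V, [/\ nbhs (inc a) U, nbhs (inc b) V
    & forall z (a' b' : fib E z),
        U (inc a') -> V (inc b') -> W (inc (a' - b'))].
Proof.
move=> /nbhs_incD[U [V [Ua]]]; rewrite -scaleN1r.
move=> /(@nbhs_incZ (-1))[K [V' [K1 Vb KV UVW]]].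
exists U, V'; split=> // z a' b' Ua' Vb'; apply: UVW => //.
by rewrite -scaleN1r; apply: KV => //; exact: nbhs_singleton.
Qed.

(** The tubes of small norm over small open sets generate a proper filter to which [zero_limit]
    applies, so they are cofinal among the neighbourhoods of the zero element. *)
Lemma nbhs_inc0 x W : nbhs (inc (0 : fib E x)) W ->
  exists d V, [/\ 0 < d, nbhs x V
    & forall z (a : fib E z), V z -> rnorm a < d -> W (inc a)].
Proof.
pose D : set (R * set X) := [set dV | 0 < dV.1 /\ nbhs x dV.2].
pose B (dV : R * set X) : set (tot E) :=
  [set e | tnorm e < dV.1 /\ dV.2 (tproj e)].
have FF : ProperFilter (filter_from D B).
  apply: filter_from_proper; last first.
    move=> [d V] [/= d0 Vx]; exists (inc (0 : fib E x)).
    rewrite /B /= tnorm_inc rnorm0 tproj_inc; split=> //.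
    exact: nbhs_singleton.
  apply: filter_from_filter.
    by exists (1, setT); split=> //; exact: filterT.
  move=> [d V] [d' V'] [/= d0 Vx] [/= d'0 V'x].
  exists (Num.min d d', V `&` V').
    by split; [rewrite /= lt_min d0|exact: filterI].
  by move=> e [/=]; rewrite lt_min => /andP[? ?] [? ?].
move=> /(zero_limit uscE FF)[].
- move=> S /= /nbhs_ballP[d /= d0 dS]; exists (d, setT).
    by split=> //; exact: filterT.
  move=> e [/= ed _]; apply: dS; rewrite /ball /= sub0r normrN ger0_norm//.
  exact: rnorm_ge0.
- by move=> V Vx; exists (1, V) => // e [].
- move=> [d V] [/= d0 Vx] dVW; exists d, V; split=> // z a Vz ad.
  by apply: dVW; split; rewrite /= ?tnorm_inc ?tproj_inc.
Qed.

End SectionExtension.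

(** * Calculus of the oscillation of a section *)

Section ApproximateContinuity.
Variables (R : realType) (X : topologicalType) (E : banachFamily R X).
Hypothesis uscE : is_usc_banach_bundle E.
Implicit Types (x y z : X) (f g : forall x, fib E x).

(** The oscillation of the section [f] at [x] is at most [e]; an arbitrary
    section is allowed, and oscillation [0] means continuity. *)
Definition osc_le f x (e : R) : Prop := forall d, 0 < d ->
  exists2 U, nbhs (inc (f x)) U
    & forall z (a : fib E z), U (inc a) -> rnorm (a - f z) < e + d.

Lemma osc_leW f x e e' : e <= e' -> osc_le f x e -> osc_le f x e'.
Proof.
move=> ee' fx d /fx[U Ux Uf]; exists U => // z a /Uf; lra.
Qed.

Lemma osc_le_near f g x e :
  (\forall z \near x, f z = g z) -> osc_le f x e -> osc_le g x e.
Proof.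
move=> fg fx d /fx[U Ux Uf].
exists (U `&` [set u | f (tproj u) = g (tproj u)]).
  rewrite -(nbhs_singleton fg); apply: filterI => //.
  exact: (nbhs_proj uscE _ fg).
by move=> z a [Ua]; rewrite /= tproj_inc => <-; exact: Uf.
Qed.

(** An element [a] near [f x + g x] is split as [b + (a - b)], where [b] in the same fibre is near
    [f x]; then [a - b] is near [g x], and each summand is compared with its own section. *)
Lemma osc_leD f g x e e' : osc_le f x e -> osc_le g x e' ->
  osc_le (fun z => f z + g z) x (e + e').
Proof.
move=> fx gx d d0.
have [U Ufx Uf] := fx (d / 2) ltac:(lra).
have [V Vgx Vg] := gx (d / 2) ltac:(lra).
have : nbhs (inc ((f x + g x) - f x)) V by rewrite addrC addKr.
move=> /(nbhs_incB uscE)[W [U' [Wfg U'f WUV]]].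
have near_f : \forall z \near x, exists b : fib E z, (U `&` U') (inc b).
  by apply: (nbhs_fib_ex uscE (a := f x)); exact: filterI.
exists (W `&` [set u | exists b : fib E (tproj u), (U `&` U') (inc b)]).
  by apply: filterI => //; exact: (nbhs_proj uscE _ near_f).
move=> z a [Wa /=]; rewrite tproj_inc => -[b [Ub U'b]].
have := Vg _ _ (WUV _ _ _ Wa U'b); have := Uf _ _ Ub.
have -> : a - (f z + g z) = (b - f z) + ((a - b) - g z).
  by rewrite addrACA subrKC opprD.
have := rnormD (b - f z) ((a - b) - g z); lra.
Qed.

Lemma real_complex_continuous : continuous (fun t : R => t%:C : R[i]^o).
Proof.
move=> t S /nbhs_ballP[e /= /gtc0_real[d d0 ->] tS].
apply/nbhs_ballP; exists d => // s; rewrite /ball /= => ts.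
apply: tS; rewrite -ball_normE /= -rmorphB normc_def /= expr0n addr0.
by rewrite sqrtr_sqr ltcR.
Qed.

(** For [a] near [l x * f x] an element [b] near [f x] is chosen over the same point, and
    [a - l * f] is split as [(a - l * b) + l * (b - f)]. *)
Lemma osc_leZ (l : X -> R) f x e : {for x, continuous l} -> osc_le f x e ->
  osc_le (fun z => (l z)%:C *: f z) x (`|l x| * e).
Proof.
move=> cl fx d d0; set L := `|l x|; have L0 : 0 <= L := normr_ge0 _.
(* The oscillation bound is tested on [f x] itself. *)
have e0 : 0 <= e.
  apply/ler_addgt0Pr => h h0; have [U Ufx Uf] := fx h h0.
  by have := Uf _ _ (nbhs_singleton Ufx); rewrite subrr rnorm0 => /ltW.
(* With [d1] and [h] below, [(L + h) * (e + d1)] is at most [L * e + d / 2]; the term [a - l * b]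
   costs another [d / 4]. The [+ 1] covers [L = 0]. *)
pose d1 := d / (4 * (L + 1)).
have d1_gt0 : 0 < d1 by rewrite divr_gt0//; lra.
have Ld1 : L * d1 <= d / 4.
  by rewrite /d1 mulrA ler_pdivrMr; [nra|lra].
pose h := d / (4 * (e + d1)).
have h_gt0 : 0 < h by rewrite divr_gt0//; lra.
have hd1 : h * (e + d1) = d / 4.
  by rewrite /h; field; lra.
have [U Ufx Uf] := fx d1 d1_gt0.
have : nbhs (inc ((l x)%:C *: f x - (l x)%:C *: f x)) [set u | tnorm u < d / 4].
  by rewrite subrr; apply: (nbhs_rnorm uscE); rewrite rnorm0; lra.
move=> /(nbhs_incB uscE)[W [V [Wlf Vlf WV]]].
have [K [U' [Kl U'f KU]]] := nbhs_incZ uscE (k := (l x)%:C) Vlf.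
have near_l : \forall z \near x, K (l z)%:C /\ `|l z| < L + h.
  apply: filterI; first exact: (cl _ (real_complex_continuous Kl)).
  apply: (cl [set t | `|t| < L + h]); apply: open_nbhs_nbhs.
  split; last by rewrite /= -/L; lra.
  apply: (@open_comp _ _ (fun t : R => `|t|) [set t | t < L + h]).
    by move=> t _; exact: norm_continuous.
  exact: open_lt.
have near_f : \forall z \near x, exists b : fib E z, (U `&` U') (inc b).
  by apply: (nbhs_fib_ex uscE (a := f x)); exact: filterI.
have near_lf : \forall z \near x, (K (l z)%:C /\ `|l z| < L + h) /\
    exists b : fib E z, (U `&` U') (inc b) by exact: filterI.
exists (W `&` [set u | (K (l (tproj u))%:C /\ `|l (tproj u)| < L + h) /\
    exists b : fib E (tproj u), (U `&` U') (inc b)]).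
  apply: filterI => //.
  exact: (nbhs_proj uscE _ near_lf).
move=> z a [Wa /=]; rewrite tproj_inc => -[[Klz lz] [b [Ub U'b]]].
have := WV _ _ _ Wa (KU _ _ _ Klz U'b); rewrite /= tnorm_inc => ab.
have bf := Uf _ _ Ub.
have := rnormB_le a ((l z)%:C *: b) ((l z)%:C *: f z).
rewrite -[X in _ <= _ + rnorm X]scalerBr rnormZ => ?.
have : `|l z| * rnorm (b - f z) <= (L + h) * (e + d1).
  by apply: ler_pM; [exact: normr_ge0|exact: rnorm_ge0|exact: ltW|exact: ltW].
rewrite mulrDl hd1 mulrDr; lra.
Qed.

(** One [e] bounds [f z]; the other bounds the elements near [f x], by upper semicontinuity of the
    norm. *)
Lemma osc_le_small f x e : (forall z, rnorm (f z) <= e) -> osc_le f x (2 * e).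
Proof.
move=> fe d d0; exists [set u | tnorm u < e + d].
  by apply: (nbhs_rnorm uscE); have := fe x; lra.
move=> z a /=; rewrite tnorm_inc => ae.
have := rnormD a (- f z); have := fe z; rewrite rnormN; lra.
Qed.

(** Write [f z = b + (f z - b)] with [b] near [f x]: the difference is small in norm, hence near the
    zero element by [nbhs_inc0]. *)
Lemma osc_le_cts f x : (forall d, 0 < d -> osc_le f x d) ->
  (fun z => inc (f z)) @ x --> inc (f x).
Proof.
move=> f0 W; rewrite -[f x]addr0 => /(nbhs_incD uscE)[U [V [Ufx V0 UVW]]].
have [d [N [d0 Nx NV]]] := nbhs_inc0 uscE V0.
have [U' U'fx U'f] := f0 (d / 2) ltac:(lra) (d / 2) ltac:(lra).
have near_f : \forall z \near x, exists b : fib E z, (U `&` U') (inc b).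
  by apply: (nbhs_fib_ex uscE (a := f x)); exact: filterI.
apply: filterS (filterI Nx near_f) => z [Nz [b [Ub U'b]]] /=.
rewrite -(subrKC b (f z)); apply: UVW => //; apply: NV => //.
by rewrite rnormBC; have := U'f _ _ U'b; lra.
Qed.

(** Subtraction is continuous at [(a, a)] and the norm is upper semicontinuous at the zero
    element. *)
Lemma thin_nbhs x (a : fib E x) d : 0 < d -> exists2 U, nbhs (inc a) U &
  forall z (b c : fib E z), U (inc b) -> U (inc c) -> rnorm (b - c) < d.
Proof.
move=> d0; have : nbhs (inc (a - a)) [set u | tnorm u < d].
  by rewrite subrr; apply: (nbhs_rnorm uscE); rewrite rnorm0.
move=> /(nbhs_incB uscE)[U [V [Ua Va UV]]].
exists (U `&` V); first exact: filterI.
by move=> z b c [Ub _] [_ Vc]; have := UV _ _ _ Ub Vc; rewrite /= tnorm_inc.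
Qed.

End ApproximateContinuity.

(** * Michael selection with prescribed values on a closed set *)

Section Selection.
Variables (R : realType) (X : topologicalType) (E : banachFamily R X).
Hypotheses (uscE : is_usc_banach_bundle E).
Hypotheses (lcX : locally_compact [set: X]) (hX : hausdorff_space X).
Implicit Types (x y z : X) (f g : forall x, fib E x).
Variables (K D : set X).
Hypotheses (closedK : closed K) (compactD : compact D) (DK : ~` D `<=` K).

Definition cts_on f : Prop := forall y, K y -> forall W, nbhs (inc (f y)) W ->
  \forall z \near y, K z -> W (inc (f z)).

(** [Q z] is a convex constraint on the value at [z]: [e]-closeness to the
    previous approximation in the iteration, and no constraint at its start. *)
Lemma approx_selection f (Q : forall z, fib E z -> Prop) (e : R) :
  0 < e -> cts_on f -> (forall z, ~ D z -> f z = 0) ->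
  (forall z (a b : fib E z) (t : R), 0 <= t <= 1 -> Q z a -> Q z b ->
     Q z (t%:C *: a + (1 - t)%:C *: b)) ->
  (forall y, exists2 U, nbhs (inc (f y)) U
     & forall z (a : fib E z), U (inc a) -> Q z a) ->
  exists g, [/\ forall z, K z -> g z = f z, forall z, Q z (g z)
              & forall z, osc_le g z e].
Proof.
move=> e0 cf fD convQ nbhsQ.
pose adm g := (forall z, K z -> g z = f z) /\ forall z, Q z (g z).
(* Compact induction composes improvements, so [P S] speaks of every admissible section: it can be
   improved on [S] without spoiling the points where its oscillation is already at most [e]. *)
pose P S := forall g, adm g -> exists2 g', adm g' &
  forall z, S z \/ osc_le g z e -> osc_le g' z e.
have admf : adm f.
  by split=> // z; have [U Uf UQ] := nbhsQ z; exact: UQ (nbhs_singleton Uf).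
suff /(_ f admf)[g [gK gQ] og] : P D.
  exists g; split=> // z; apply: og.
  (* Off [D] the section [f] vanishes locally, so the bound holds before any improvement. *)
  have [Dz|nDz] := pselect (D z); [by left|right].
  apply: (@osc_le_near _ _ _ uscE (fun z => 0)); last first.
    apply: osc_leW (ltW e0) _; rewrite -(mulr0 2).
    by apply: (osc_le_small uscE) => w; rewrite rnorm0.
  have : nbhs z (~` D).
    apply: open_nbhs_nbhs; split=> //; apply: closed_openC.
    exact: compact_closed.
  by apply: filterS => w /fD ->.
apply: (compact_ind (P := P) compactD).
- by move=> g ag; exists g => // z [].
- move=> S T ST PT g /PT[g' ag' og']; exists g' => // z [/ST|] ?; apply: og'.
    by left.
  by right.
- move=> S T PS PT g /PS[g1 /PT[g2 a2 og2] og1]; exists g2 => // z.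
  by move=> [[Sz|Tz]|og]; apply: og2; [right|left|right]; auto.
move=> y _.
have [Uthin thin_f Uthin_e] := thin_nbhs uscE (f y) e0.
have [UQ Qf UQQ] := nbhsQ y.
pose U := (Uthin `&` UQ)^°.
have Uf : nbhs (inc (f y)) U.
  apply: open_nbhs_nbhs; split; first exact: open_interior.
  exact: filterI.
have openU a : U a -> nbhs a U.
  by move=> Ua; apply: open_nbhs_nbhs; split=> //; exact: open_interior.
have nearK : \forall z \near y, K z -> U (inc (f z)).
  have [Ky|nKy] := pselect (K y); first exact: cf.
  have : nbhs y (~` K).
    by apply: open_nbhs_nbhs; split=> //; exact: closed_openC.
  by apply: filterS.
pose V := [set z | (K z -> U (inc (f z))) /\ exists b : fib E z, U (inc b)]^°.
have Vy : nbhs y V.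
  apply: open_nbhs_nbhs; split; first exact: open_interior.
  by apply: (filterI nearK); exact: (nbhs_fib_ex uscE Uf).
(* On [K] the value is forced; elsewhere any element of [U] will do. Since [U] is [e]-thin, this
   possibly discontinuous choice has oscillation at most [e] over [V]. *)
pose s z : fib E z := if pselect (K z) then f z else xget 0 [set b | U (inc b)].
have Us z : V z -> U (inc (s z)).
  move=> /interior_subset[UK [b Ub]]; rewrite /s; case: pselect => [Kz|nKz] /=.
    exact: UK.
  by case: xgetP => [_ -> //|/(_ b)].
have oscs z : V z -> osc_le s z e.
  move=> Vz d d0; exists (U `&` [set u | V (tproj u)]).
    apply: filterI; first exact/openU/Us.
    apply: (nbhs_proj uscE); apply: open_nbhs_nbhs; split=> //.
    exact: open_interior.
  move=> w a [/interior_subset[Ua _]]; rewrite /= tproj_inc => /Us.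
  by move=> /interior_subset[Usw _]; have := Uthin_e _ _ _ Ua Usw; lra.
have [l [cl l01 [F [cF FV lF]] l1]] := bump_function R lcX hX Vy.
exists [set z | l z = 1]^°.
  by apply: open_nbhs_nbhs; split=> //; exact: open_interior.
(* The blend stays admissible: [s] and [g] both equal [f] on [K], and over [F], hence over [V], both
   satisfy the convex condition [Q]. *)
move=> g [gK gQ]; pose g' z := (l z)%:C *: s z + (1 - l z)%:C *: g z.
have g'g z : ~ F z -> g' z = g z.
  by move=> /lF; rewrite /g' => ->; rewrite scale0r add0r subr0 scale1r.
exists g'.
  split=> z.
    move=> Kz; rewrite /g' /s; case: pselect => // ?; rewrite gK// -scalerDl.
    by rewrite -rmorphD/= subrKC scale1r.
  have [/FV Vz|/g'g -> //] := pselect (F z).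
  apply: convQ => //.
  by have [_ /UQQ] := interior_subset (Us z Vz).
have cl' : continuous (fun z => 1 - l z).
  by move=> z; apply: cvgB; [exact: cvg_cst|exact: cl].
(* The blend is [s] near [z] in the first case and [g] near any [z] outside [F]. At the remaining
   points both have oscillation at most [e], and the weights add up to one. *)
move=> z [l1z|ogz].
  have Vz : V z.
    apply: FV; apply: contrapT => /lF; have /= -> := interior_subset l1z.
    by move=> /eqP; rewrite oner_eq0.
  apply: (@osc_le_near _ _ _ uscE s); last exact: oscs.
  have : nbhs z [set z | l z = 1] by exact: l1z.
  by apply: filterS => w /= lw; rewrite /g' lw subrr scale0r addr0 scale1r.
have [Fz|nFz] := pselect (F z); last first.
  apply: (@osc_le_near _ _ _ uscE g) => //.
  have : nbhs z (~` F).
    by apply: open_nbhs_nbhs; split=> //; exact: closed_openC.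
  by apply: filterS => w /g'g.
have -> : e = `|l z| * e + `|1 - l z| * e.
  have /andP[l0 l1'] := l01 z.
  by rewrite -mulrDl !ger0_norm ?subr_ge0// subrKC mul1r.
apply: (osc_leD uscE); apply: (osc_leZ uscE); rewrite //.
- exact: cl.
- exact/oscs/FV.
- exact: cl'.
Qed.

(** Every approximation agrees with [h] on [K], which contains the complement of [D]; so all of them
    vanish off the compact set [D], and [approx_selection] can be applied again. *)
Lemma section_extension (h : forall x, fib E x) :
  cts_on h -> (forall z, ~ D z -> h z = 0) ->
  exists2 f : forall x, fib E x, continuous (fun z => inc (f z))
    & forall z, K z -> f z = h z.
Proof.
move=> ch hD; pose e n : R := 2^-1 ^+ n.
have e_gt0 n : 0 < e n by rewrite exprn_gt0// invr_gt0.
have eS n : e n = 2 * e n.+1 by rewrite /e exprS mulVKf.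
pose good n f := (forall z, K z -> f z = h z) /\ forall z, osc_le f z (e n).
have [f0 f0good] : exists f, good 0%N f.
  have [||f [? _ ?]] := @approx_selection h (fun _ _ => True) 1 ltr01 ch hD.
  - by [].
  - by move=> y; exists setT => //; exact: filterT.
  - by exists f; split=> // z; rewrite /e expr0.
have /choice[next nextP] : forall nf : nat * (forall x, fib E x), exists g,
    good nf.1 nf.2 ->
    good nf.1.+1 g /\ forall z, rnorm (g z - nf.2 z) <= 2 * e nf.1.
  move=> [n f] /=; have [[fK fosc]|] := pselect (good n f); last by exists f.
  have cf : cts_on f.
    move=> y Ky W; rewrite fK// => /(ch y Ky); apply: filterS => z + Kz.
    by rewrite fK//; exact.
  have fD z : ~ D z -> f z = 0 by move=> Dz; rewrite fK ?hD//; exact: DK.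
  (* The bound [2 * e n] is the oscillation [e n] of [f] plus a slack of [e n], so all elements near
     [f y] satisfy it. *)
  have [||g [gK gQ gosc]] := @approx_selection f
      (fun z a => rnorm (a - f z) <= 2 * e n) (e n.+1) (e_gt0 _) cf fD.
  - move=> z a b t /andP[t0 t1] az bz.
    have -> : t%:C *: a + (1 - t)%:C *: b - f z =
        t%:C *: (a - f z) + (1 - t)%:C *: (b - f z).
      rewrite !scalerBr addrACA -opprD -scalerDl -rmorphD/=.
      by rewrite subrKC scale1r.
    apply: le_trans (rnormD _ _) _; rewrite !rnormZ !ger0_norm ?subr_ge0//.
    have t1' : 0 <= 1 - t by lra.
    by have := ler_wpM2l t0 az; have := ler_wpM2l t1' bz; lra.
  - move=> y; have [U Uf Ub] := fosc y (e n) (e_gt0 n).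
    by exists U => // z a /Ub; have := e_gt0 n; lra.
  - by exists g => _; split=> //; split=> // z Kz; rewrite gK// fK.
pose f n := nat_rect (fun=> forall x, fib E x) f0 (fun n g => next (n, g)) n.
have fgood n : good n (f n).
  by elim: n => //= n /(nextP (n, f n))[].
have fS n z : rnorm (f n.+1 z - f n z) <= 2 * e n.
  by have [_] := nextP (n, f n) (fgood n); exact.
(* The steps [2 * e n] form a geometric series with ratio one half, whose partial sums are these
   differences. *)
have fcauchy n k z : rnorm (f (n + k)%N z - f n z) <= 4 * e n - 4 * e (n + k)%N.
  elim: k => [|k IH]; first by rewrite addn0 !subrr rnorm0.
  rewrite addnS; have := fS (n + k)%N z; have := eS (n + k)%N.
  have := rnormB_le (f (n + k).+1 z) (f (n + k)%N z) (f n z); lra.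
have small t : 0 < t -> exists n, e n < t.
  move=> t0; have : e @ \oo --> (0 : R).
    by apply: cvg_expr; rewrite gtr0_norm ?invf_lt1 ?ltr1n.
  move=> /cvgrPdist_lt/(_ t t0)[n _ /(_ n (leqnn n))].
  by rewrite sub0r normrN gtr0_norm// => ?; exists n.
have flim z : exists a : fib E z, f n z @[n --> \oo] --> a.
  apply: rnorm_cauchy_cvg => t t0; have [N eN] := small (t / 4) ltac:(lra).
  exists N => m Nm; have := fcauchy N (m - N)%N z; rewrite subnKC//.
  by have := e_gt0 m; lra.
pose g z := projT1 (cid (flim z)).
have gf n z : rnorm (g z - f n z) <= 4 * e n.
  apply/ler_addgt0Pr => t t0.
  have /(_ [set a | rnorm (a - g z) < t])[|N _ fN] := projT2 (cid (flim z)).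
    by apply/nbhs_rnormP; exists t.
  have := fN (n + N)%N (leq_addl _ _); rewrite /= rnormBC => gN.
  have := rnormB_le (g z) (f (n + N)%N z) (f n z).
  by have := fcauchy n N z; have := e_gt0 (n + N)%N; lra.
exists g => [z|z Kz].
  (* The oscillation of [f n] is at most [e n], and that of the remainder [g - f n] at most
     [8 * e n]. *)
  apply: (osc_le_cts uscE) => d d0; have [n en] := small (d / 9) ltac:(lra).
  apply: (@osc_leW _ _ _ _ _ (e n + 2 * (4 * e n))); first by lra.
  have -> : g = (fun z => f n z + (g z - f n z)).
    by apply: functional_extensionality_dep => w; rewrite subrKC.
  apply: (osc_leD uscE); first by case: (fgood n).
  by apply: (osc_le_small uscE) => w; exact: gf.
apply/eqP; rewrite -subr_eq0 -normr_eq0 normrE.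
suff -> : rnorm (g z - h z) = 0 by [].
apply/eqP; rewrite eq_le rnorm_ge0 andbT; apply/ler_addgt0Pr => t t0.
rewrite add0r; have [n en] := small (t / 4) ltac:(lra).
by have [fK _] := fgood n; rewrite -(fK z Kz); have := gf n z; lra.
Qed.

End Selection.

(** * Topology of étale groupoids *)

Lemma cvg_within_comp (S T U : topologicalType) (D : set T) (f : T -> U)
    (u : S -> T) (y : S) :
  {within D, continuous f} -> u @ y --> u y -> (\forall z \near y, D (u z)) ->
  (fun z => f (u z)) @ y --> f (u y).
Proof.
move=> /subspace_continuousP cf cu Du W.
move=> /(cf _ (nbhs_singleton Du))/cu fu.
have fy : nbhs y [set z | D (u z) -> W (f (u z))] by exact: fu.
suff : nbhs y [set z | W (f (u z))] by [].
by apply: filterS (filterI fy Du) => z [h /h].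
Qed.

Lemma cvg_pair_to (S T U : topologicalType) (u : S -> T) (v : S -> U) (y : S) :
  u @ y --> u y -> v @ y --> v y ->
  (fun z => (u z, v z)) @ y --> ((u y, v y) : T * U).
Proof. by move=> cu cv; exact: (cvg_pair cu cv). Qed.

Section EtaleGroupoid.
Variable G : topGroupoid.
Implicit Types x y z : G.

Lemma grng_idem x : grng (grng x) = grng x.
Proof. exact: (grngM (composable_V x)). Qed.

Lemma cvg_gmul (S : topologicalType) (u v : S -> G) (s : S) :
  u @ s --> u s -> v @ s --> v s ->
  (\forall t \near s, composable (u t) (v t)) ->
  (fun t => gmul (u t) (v t)) @ s --> gmul (u s) (v s).
Proof.
move=> cu cv uv.
exact: (cvg_within_comp (u := fun t => (u t, v t)) (@g_mul_continuous G)
  (cvg_pair_to cu cv) uv).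
Qed.

Lemma grng_continuous : continuous (@grng G).
Proof.
move=> x; apply: cvg_gmul; [exact: cvg_id|exact: g_inv_continuous|].
by apply: nearW => y; exact: composable_V.
Qed.

Lemma gsrc_continuous : continuous (@gsrc G).
Proof.
move=> x; apply: cvg_gmul; [exact: g_inv_continuous|exact: cvg_id|].
by apply: nearW => y; exact: composableV_.
Qed.

(** Shrink [W] to an open subset of a bisection: its range is relatively open in the unit space. *)
Lemma etale_nbhs x W : etale G -> nbhs x W ->
  \forall y \near grng x, units y -> exists2 w, W w & grng w = y.
Proof.
move=> eG Wx; have [U [oU Ux _ opr]] := eG x.
have [||V oV WV] := opr (W^° `&` U).
- exact: openI (@open_interior _ _) oU.
- exact: subIsetr.
have [Vx _] : (V `&` @units G) (grng x) by rewrite -WV; exists x.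
have : nbhs (grng x) V by exact: open_nbhs_nbhs.
apply: filterS => y Vy uy; have : (V `&` @units G) y by [].
by rewrite -WV => -[w [/interior_subset Ww _] wy]; exists w.
Qed.

Lemma gmulK x y : composable x y -> gmul (ginv x) (gmul x y) = y.
Proof.
move=> xy; rewrite (groupoid_mulA (g_groupoid G))//; last exact: gsrcV.
rewrite -/(gsrc x) xy; exact: (groupoid_mul_r (g_groupoid G)).
Qed.

Lemma gmulVK x z : grng x = grng z -> gmul x (gmul (ginv x) z) = z.
Proof.
move=> xz; have := @gmulK (ginv x) z; rewrite ginvK; apply.
by rewrite /composable gsrcV.
Qed.

End EtaleGroupoid.

(** * The kernel of the cocycle and the boundary *)

Section Kernel.
Variables (R : realType) (G : topGroupoid) (c : cocycle R G).
Hypotheses (eG : etale G) (eK : etale (sub_groupoid (coc_kernel c))).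
Implicit Types x y z : G.

Lemma coc_grng x : c (grng x) = 0.
Proof. by rewrite [LHS](cocM c (composable_V x)) cocV subrr. Qed.

(** Take a bisection [U] of [G] at [x]. Étaleness of the kernel gives, for [z] in [U] near [x], a
    kernel arrow [w] in [U] with the same range as [z]; injectivity of the range map on [U] forces
    [z = w]. *)
Lemma coc_kernel_open : open [set x | c x = 0].
Proof.
rewrite openE => x /= cx0; have [U [oU Ux injU _]] := eG x.
have cxK : sgset (coc_kernel c) x by exact: cx0.
pose x' : coc_kernel c := exist _ x (mem_set cxK).
have /(etale_nbhs eK) : nbhs x' (set_val @^-1` U).
  apply: (@set_val_continuous _ (coc_kernel c)); exact: open_nbhs_nbhs.
rewrite /prop_near1 nbhsE => -[_ [[B oB <-] Bx] Bsub].
have Brx : B (grng x) by rewrite -(sub_grng x').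
have : nbhs x (U `&` @grng G @^-1` B).
  apply: filterI; first exact: open_nbhs_nbhs.
  by apply: grng_continuous; exact: open_nbhs_nbhs.
apply: filterS => z [Uz Brz] /=.
have rzK : sgset (coc_kernel c) (grng z) by exact: coc_grng.
pose y : coc_kernel c := exist _ (grng z) (mem_set rzK).
have uy : @units (sub_groupoid (coc_kernel c)) y.
  by exists y => //; apply: set_val_inj_sub; rewrite sub_grng; exact: grng_idem.
have [w Uw wy] := Bsub y Brz uy.
suff -> : z = set_val w by exact: (set_type_in w).
apply: injU; rewrite ?inE//; rewrite -sub_grng wy.
by [].
Qed.

Lemma coc_kernel_clopen : clopen [set x | c x = 0].
Proof.
split; first exact: coc_kernel_open.
have : closed (c @^-1` [set 0 : R]).
  apply: preimage_closed; last exact: closed_eq.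
  by move=> x _; exact: coc_continuous.
by [].
Qed.

Lemma boundary_grngP x : boundary c (grng x) <->
  forall g, grng g = grng x -> c g <= 0.
Proof. by split=> [[]//|h]; split=> //; exact: imageT. Qed.

(** An arrow with positive cocycle value and range [grng x] can be moved, by étaleness, to one
    ending at [grng y] for every [y] near [x]. *)
Lemma boundary_grng_closed : closed [set x | boundary c (grng x)].
Proof.
rewrite -openC openE => x /=.
move=> /boundary_grngP/existsNP[g /not_implyP[gx /negP]]; rewrite -ltNge => cg.
have Wg : nbhs g [set g | 0 < c g].
  apply: (@coc_continuous _ _ c g [set t : R | 0 < t]).
  by apply: open_nbhs_nbhs; split; [exact: open_gt|].
have := etale_nbhs eG Wg; rewrite gx => Wx.
have : nbhs x [set y | exists2 h, 0 < c h & grng h = grng y].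
  have : nbhs x [set y | units (grng y) ->
      exists2 w, 0 < c w & grng w = grng y] by exact: grng_continuous Wx.
  by apply: filterS => y /(_ (imageT _ _)).
apply: filterS => y [h /= ch hy] /boundary_grngP/(_ h hy).
by rewrite leNgt ch.
Qed.

Lemma reduction_closed : closed (reduction (boundary c)).
Proof.
apply: closedI; first exact: boundary_grng_closed.
have -> : (fun x => boundary c (gsrc x)) =
    @ginv G @^-1` [set x | boundary c (grng x)].
  by apply/funext => x /=; rewrite grngV.
by apply: preimage_closed boundary_grng_closed => x _; exact: g_inv_continuous.
Qed.

(** The boundary condition applies to [x] at its range and to [ginv x] at its source. *)
Lemma reduction_sub_kernel : reduction (boundary c) `<=` [set x | c x = 0].
Proof.
move=> x [[_ /(_ x erefl) cx] [_ /(_ (ginv x) (grngV x))]] /=.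
by rewrite cocV; lra.
Qed.

(** Left multiplication by [x] does not change the value of [c] and carries arrows ending at
    [gsrc x] to arrows ending at [grng x]. *)
Lemma boundary_invariant x :
  c x = 0 -> boundary c (grng x) -> boundary c (gsrc x).
Proof.
move=> cx [_ rx]; split; first exact: units_src.
move=> g gx; have xg : composable x g by rewrite /composable.
by have := rx _ (grngM xg); rewrite (cocM c xg) cx add0r.
Qed.

End Kernel.

(** * Convolution by sections supported in bisections *)

Section Convolution.
Variables (R : realType) (G : topGroupoid) (A : fellBundle R G).
Implicit Types (x y z : G) (f g : bsection A) (S : set G).

Let axA := fb_axioms A.
Let uscA := fell_bundle axA.

Lemma inc_fibmul x y (a : fib A x) (b : fib A y) : composable x y ->
  inc (fibmul (@fb_mul _ _ A) (gmul x y) a b) = fb_mul (inc a) (inc b).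
Proof.
move=> xy; apply: inc_at_fib; rewrite (fell_proj_mul axA) ?tproj_inc//.
by rewrite /tcomposable !tproj_inc.
Qed.

Lemma fibmul0l x y (b : fib A y) : composable x y ->
  fibmul (@fb_mul _ _ A) (gmul x y) (0 : fib A x) b = 0.
Proof.
move=> xy; have := bilinear_l (fell_mul_bilinear axA xy) 1 0 0 b.
by rewrite scaler0 addr0 scale1r => /eqP; rewrite -subr_eq subrr => /eqP.
Qed.

Lemma fibmul0r x y (a : fib A x) : composable x y ->
  fibmul (@fb_mul _ _ A) (gmul x y) a (0 : fib A y) = 0.
Proof.
move=> xy; have := bilinear_r (fell_mul_bilinear axA xy) 1 a 0 0.
by rewrite scaler0 addr0 scale1r => /eqP; rewrite -subr_eq subrr => /eqP.
Qed.

Lemma zero_section_continuous : continuous (fun x => inc (0 : fib A x)).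
Proof.
move=> x; apply: (osc_le_cts uscA (f := fun x => 0)) => d d0.
have -> : d = 2 * (d / 2) by lra.
by apply: (osc_le_small uscA) => z; rewrite rnorm0; lra.
Qed.

Lemma sec_conv_eq0 f g x :
  (forall a, grng a = grng x -> f a = 0) -> sec_conv f g x = 0.
Proof.
move=> f0; apply: fsbig1 => -[a b] /= [ab abx].
rewrite f0; last by rewrite -abx grngM.
by rewrite -abx fibmul0l.
Qed.

(** A left factor of [x] on which [f] is nonzero lies in [U] and has the range of [x], so it is [a]:
    one term of the sum survives. *)
Lemma sec_conv_bisection f g (U : set G) a x :
  set_inj U (@grng G) -> [set y | f y != 0] `<=` U ->
  U a -> grng a = grng x ->
  sec_conv f g x = fibmul (@fb_mul _ _ A) x (f a) (g (gmul (ginv a) x)).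
Proof.
move=> injU fU Ua ax; rewrite /sec_conv.
rewrite -(@fsbig_widen _ _ _ _ [set (a, gmul (ginv a) x)]).
- by rewrite fsbig_set1.
- move=> _ -> /=; split; last exact: gmulVK.
  by rewrite /composable grngM ?grngV// /composable gsrcV.
- move=> [a' b'] [/= [ab' abx] nab]; rewrite /preimage /=.
  have [->|/eqP fa'] := eqVneq (f a') 0; first by rewrite -abx fibmul0l.
  have aa' : a' = a.
    apply: injU; rewrite ?inE//; first exact/fU/eqP.
    by rewrite ax -abx grngM.
  by case: nab; rewrite -aa' -abx gmulK.
Qed.

Hypotheses (hG : hausdorff_space G) (eG : etale G).

Lemma sec_conv_continuous f g (U : set G) :
  Cc f -> Cc g -> open U -> set_inj U (@grng G) ->
  closure [set x | f x != 0] `<=` U ->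
  continuous (fun x => inc (sec_conv f g x)).
Proof.
move=> [cf kf] [cg _] oU injU fU x0.
have [[a0 [Ua0 ax0]]|na0] := pselect (exists a0, U a0 /\ grng a0 = grng x0).
  pose al x := xget a0 [set a | U a /\ grng a = grng x].
  have alP x : (exists a, U a /\ grng a = grng x) ->
      U (al x) /\ grng (al x) = grng x.
    by rewrite /al; case: xgetP => [a -> //|na [a /na]].
  have near_al W : nbhs a0 W ->
      \forall x \near x0, exists2 a, (W `&` U) a & grng a = grng x.
    move=> Wa; have := @etale_nbhs G a0 (W `&` U) eG; rewrite ax0.
    move=> /(_ (filterI Wa (open_nbhs_nbhs (conj oU Ua0)))) N.
    have : nbhs x0 [set y | units (grng y) ->
      exists2 w, (W `&` U) w & grng w = grng y] by exact: grng_continuous N.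
    by apply: filterS => y /(_ (imageT _ _)).
  have al_uniq x a : U a -> grng a = grng x -> al x = a.
    move=> Ua ax; have [|Ual alx] := alP x; first by exists a.
    by apply: injU; rewrite ?inE// alx.
  have al0 : al x0 = a0 by exact: al_uniq.
  have cal : al @ x0 --> al x0.
    rewrite al0 => W /near_al N.
    suff : nbhs x0 [set x | W (al x)] by [].
    by apply: filterS N => x [a [Wa Ua] ax] /=; rewrite (al_uniq _ a).
  have Nal : \forall x \near x0, U (al x) /\ grng (al x) = grng x.
    apply: filterS (near_al setT filterT) => x [a [_ Ua] ax].
    by apply: alP; exists a.
  have cmp x : U (al x) /\ grng (al x) = grng x -> composable (ginv (al x)) x.
    by move=> [_ ?]; rewrite /composable gsrcV.
  have cmp' x : U (al x) /\ grng (al x) = grng x ->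
      composable (al x) (gmul (ginv (al x)) x).
    by move=> /cmp h; rewrite /composable grngM// grngV.
  have convE x : U (al x) /\ grng (al x) = grng x -> inc (sec_conv f g x) =
      fb_mul (inc (f (al x))) (inc (g (gmul (ginv (al x)) x))).
    move=> h; have [Ua ax] := h.
    rewrite (sec_conv_bisection _ injU _ Ua ax); last first.
      by move=> y fy; apply/fU/subset_closure.
    rewrite -(inc_fibmul _ _ (cmp' x h)).
    by rewrite gmulVK.
  have cbe : (fun x => gmul (ginv (al x)) x) @ x0 --> gmul (ginv (al x0)) x0.
    apply: (cvg_gmul (u := fun x => ginv (al x))).
    - by move=> W /(@g_inv_continuous G)/cal.
    - exact: cvg_id.
    - exact: filterS cmp Nal.
  have : (fun x => fb_mul (inc (f (al x))) (inc (g (gmul (ginv (al x)) x))))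
      @ x0 --> fb_mul (inc (f (al x0))) (inc (g (gmul (ginv (al x0)) x0))).
    apply: (cvg_within_comp
      (u := fun x => (inc (f (al x)), inc (g (gmul (ginv (al x)) x))))
      (fell_mul_continuous axA)).
      apply: cvg_pair_to; first by move=> W /cf/cal.
      by move=> W /cg/cbe.
    by apply: filterS Nal => x /cmp'; rewrite /= /tcomposable !tproj_inc.
  rewrite -(convE x0 (nbhs_singleton Nal)) => cconv W /cconv Wc.
  suff : nbhs x0 [set x | W (inc (sec_conv f g x))] by [].
  have Wx : nbhs x0 [set x | W (fb_mul (inc (f (al x)))
    (inc (g (gmul (ginv (al x)) x))))] by exact: Wc.
  by apply: filterS (filterI Wx Nal) => x [+ /convE /= ->].
(* No arrow of [U] has the range of [x0]. The ranges of the support of [f] form a compact, hence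
   closed, set missing [grng x0], so the convolution vanishes near [x0]. *)
have cr : closed (@grng G @` closure [set x | f x != 0]).
  apply: compact_closed => //; apply: continuous_compact => //.
  by apply: continuous_subspaceT; exact: grng_continuous.
have N : \forall x \near x0,
    (~` (@grng G @` closure [set x | f x != 0])) (grng x).
  apply: grng_continuous; apply: open_nbhs_nbhs.
  split; first exact: closed_openC.
  by move=> [a /fU Ua ax]; apply: na0; exists a.
have conv0 x : (~` (@grng G @` closure [set x | f x != 0])) (grng x) ->
    sec_conv f g x = 0.
  move=> nx; apply: sec_conv_eq0 => a ax; apply: contrapT => /eqP fa.
  by apply: nx; exists a => //; exact: subset_closure.
move=> W /=; rewrite (conv0 x0 (nbhs_singleton N)).
move=> /(@zero_section_continuous x0) W0.
have {}W0 : nbhs x0 [set x | W (inc (0 : fib A x))] by exact: W0.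
suff : nbhs x0 [set x | W (inc (sec_conv f g x))] by [].
by apply: filterS (filterI W0 N) => x [+ /conv0 /= ->].
Qed.

Lemma composable_closed : closed [set xy : G * G | composable xy.1 xy.2].
Proof.
move=> [x y] cxy; apply: hG => V W Vx Wy.
have [|[a b] [/= ab [Va Wb]]] :=
    cxy ((@gsrc G @^-1` V) `*` (@grng G @^-1` W)).
  by exists (@gsrc G @^-1` V, @grng G @^-1` W) => //; split;
    [exact: gsrc_continuous|exact: grng_continuous].
by exists (gsrc a); split=> //; rewrite ab.
Qed.

(** The support lies in the image under multiplication of the composable pairs in the product of the
    two supports, a compact set. *)
Lemma sec_conv_compact_support f g : Cc f -> Cc g ->
  compact (closure [set x | sec_conv f g x != 0]).
Proof.
move=> [_ kf] [_ kg].
pose D := [set xy : G * G | composable xy.1 xy.2].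
pose M := (closure [set x | f x != 0] `*` closure [set x | g x != 0]) `&` D.
have kM : compact ((fun xy : G * G => gmul xy.1 xy.2) @` M).
  apply: continuous_compact.
    by apply: continuous_subspaceW (@g_mul_continuous G) => xy [].
  by apply: compact_closedI; [exact: compact_setX|exact: composable_closed].
apply: (subclosed_compact _ kM); first exact: closed_closure.
have /closure_id -> := compact_closed hG kM.
apply: closureS => x; apply: contraPP => nMx; apply/negP/negPn/eqP.
apply: fsbig1 => -[a b] /= [ab abx]; rewrite -abx.
have [->|fa] := eqVneq (f a) 0; first exact: fibmul0l.
have [->|gb] := eqVneq (g b) 0; first exact: fibmul0r.
by case: nMx; exists (a, b) => //; split=> //; split; exact: subset_closure.
Qed.

Lemma Cc_sec_conv f g (U : set G) :
  Cc f -> Cc g -> open U -> set_inj U (@grng G) ->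
  closure [set x | f x != 0] `<=` U -> Cc (sec_conv f g).
Proof.
move=> cf cg oU injU fU; split; last exact: sec_conv_compact_support.
exact: sec_conv_continuous injU fU.
Qed.

Lemma Cc_sec_mul (l : G -> R) f : continuous l -> Cc f ->
  Cc (fun x => (l x)%:C *: f x).
Proof.
move=> cl [cf kf]; split; last first.
  apply: (subclosed_compact _ kf); first exact: closed_closure.
  apply: closureS => x /=; apply: contraNneq => ->.
  by rewrite scaler0.
have -> : (fun x => inc ((l x)%:C *: f x)) =
    (fun x => tscale (l x)%:C (inc (f x))).
  by apply/funext => x; rewrite tscale_inc.
move=> x; have clf : (fun y => ((l y)%:C : R[i]^o, inc (f y))) @ x -->
    (((l x)%:C : R[i]^o), inc (f x)).
  apply: cvg_pair_to; last exact: cf.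
  by move=> W /(@real_complex_continuous R)/cl.
by move=> W /(@tscale_continuous _ _ _ uscA (_, _))/clf.
Qed.

End Convolution.

(** * Restriction of sections to closed subgroupoids *)

Lemma compact_set_val_preimage (X : topologicalType) (K C : set X) :
  closed K -> compact C -> compact ((set_val : K -> X) @^-1` C).
Proof.
(* The filter is pushed forward to [X], where it clusters at a point of [C]; closedness of [K]
   brings that point back to [K]. *)
move=> cK cC F FF FC; have FvF : ProperFilter (set_val @ F).
  exact: fmap_proper_filter.
have FK : (set_val @ F) K.
  suff : F (set_val @^-1` K) by [].
  by apply: filterS FC => x _; exact: set_type_in.
have [p [Cp clp]] := cC _ FvF FC.
have Kp : K p by apply: cK => W; exact: clp.
exists (exist _ p (mem_set Kp)); split=> // S W FS.
rewrite nbhsE => -[_ [[N oN <-] Np] NW].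
have FvS : (set_val @ F) (set_val @` S).
  suff : F (set_val @^-1` (set_val @` S)) by [].
  by apply: filterS FS => x; exists x.
have [|_ [[x Sx <-] Nx]] := clp _ N FvS; first exact: open_nbhs_nbhs.
by exists x; split=> //; exact: NW.
Qed.

Section RestrictSections.
Variables (R : realType) (G : topGroupoid) (A : fellBundle R G).

Lemma Cc_sec_restrict (K : subgroupoid G) (f : bsection A) : closed K ->
  Cc f -> Cc (sec_restrict (K := K) f).
Proof.
move=> cK [cf kf]; split.
  apply: set_type_continuous => /=.
  exact: (comp_continuous (@set_val_continuous G K) cf).
apply: (subclosed_compact _ (compact_set_val_preimage cK kf)).
  exact: closed_closure.
have clo : closed (set_val @^-1` closure [set x | f x != 0] : set K).
  apply: preimage_closed; last exact: closed_closure.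
  by move=> x _; exact: set_val_continuous.
have /closure_id -> := clo.
by apply: closureS => x fx; exact: subset_closure.
Qed.

(** Let [x] in the reduction factor as [a b] with [f a] nonzero. Then [c a = 0], so invariance
    carries the boundary from the range of [a] to its source, which is the range of [b]: both
    factors lie in the reduction. *)
Lemma sec_conv_restrict (c : cocycle R G) (f g : bsection A) :
  [set x | f x != 0] `<=` [set x | c x = 0] ->
  sec_restrict (K := reduction (boundary c)) (sec_conv f g) =
  sec_conv (sec_restrict f) (sec_restrict g).
Proof.
move=> fc; apply: functional_extensionality_dep => x.
set K := reduction (boundary c).
pose h (ab : sub_groupoid K * sub_groupoid K) : G * G :=
  (set_val ab.1, set_val ab.2).
pose D := [set ab : sub_groupoid K * sub_groupoid K |
  composable ab.1 ab.2 /\ gmul ab.1 ab.2 = x].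
transitivity (\sum_(ab \in h @` D)
    fibmul (@fb_mul _ _ A) (set_val x) (f ab.1) (g ab.2)).
  apply/esym/fsbig_widen => [_ [[a b] [/= ab abx] <-]|[a b] [/= [ab abx] nab]].
    have ab' := sub_composable ab.
    by split=> //; rewrite -abx /h /=; exact: esym (set_val_mul ab').
  rewrite /preimage /= -abx.
  have [->|fa] := eqVneq (f a) 0; first exact: fibmul0l.
  have ca := fc a fa.
  have [Zr Zs] := set_type_in x.
  have Zra : boundary c (grng a) by rewrite -(grngM ab) abx.
  have Zsb : boundary c (gsrc b) by rewrite -(gsrcM ab) abx.
  have Zsa := boundary_invariant ca Zra.
  have Ka : sgset K a by split.
  have Kb : sgset K b by split; rewrite // -ab.
  case: nab; exists (exist _ a (mem_set Ka), exist _ b (mem_set Kb)) => //.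
  split.
    by apply: set_val_inj_sub; rewrite sub_gsrc sub_grng.
  by apply: set_val_inj_sub; rewrite set_val_mul.
rewrite (@reindex_fsbig _ _ _ _ _ h D); last first.
  apply: inj_bij => -[a b] [a' b'] _ _ [].
  by move=> /(@set_val_inj_sub _ K) -> /(@set_val_inj_sub _ K) ->.
apply: eq_fsbigr => -[a b] /set_mem[/= ab abx].
by rewrite fibmul_res.
Qed.

End RestrictSections.

(** * Extension of compactly supported sections *)

Section ExtendSections.
Variables (R : realType) (G : topGroupoid) (A : fellBundle R G).
Hypotheses (lcG : locally_compact [set: G]) (hG : hausdorff_space G).

(** Besides the values on [K], the value zero is prescribed off the interior of a compact
    neighbourhood [D] of the support. This makes the selection theorem applicable, and [D] inside
    [W] controls the support. *)
Lemma Cc_extension (K : subgroupoid G) (W : set G)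
    (h : bsection (restriction A K)) :
  closed K -> clopen W -> K `<=` W -> Cc h ->
  exists f : bsection A,
    [/\ Cc f, [set x | f x != 0] `<=` W & sec_restrict f = h].
Proof.
move=> cK clW KW [ch kh]; have uscA := fell_bundle (fb_axioms A).
pose C : set G := set_val @` closure [set x | h x != 0].
have kC : compact C.
  apply: continuous_compact => //; apply: continuous_subspaceT.
  exact: set_val_continuous.
have CW : C `<=` W by move=> _ [x _ <-]; apply: KW; exact: set_type_in.
have [D [kD DW CD]] := compact_neighbourhood lcG kC clW CW.
pose h' z : fib A z := match pselect (sgset K z) with
  | left Kz => h (exist _ z (mem_set Kz)) | right _ => 0 end.
have h'K (x : sub_groupoid K) : h' (set_val x) = h x.
  case: x => z Kz; rewrite /h'; case: pselect => [Kz'|[]]; last exact: set_mem.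
  by rewrite (bool_irrelevance (mem_set Kz') Kz).
have h'0 z : ~ C z -> h' z = 0.
  move=> nCz; have [Kz|nKz] := pselect (sgset K z); last first.
    by rewrite /h'; case: pselect.
  pose x : sub_groupoid K := exist _ z (mem_set Kz).
  rewrite (h'K x); apply: contrapT => /eqP hx; apply: nCz.
  by exists x => //; exact: subset_closure.
have clC : closed C by exact: compact_closed.
have subD : ~` D `<=` K `|` ~` D^° by move=> z nDz; right => /interior_subset.
have clKD : closed (K `|` ~` D^°).
  by apply: closedU => //; exact/open_closedC/open_interior.
have [||f cf fh] :=
    @section_extension _ _ A uscA lcG hG _ D clKD kD subD h'.
(* Outside [C] the data vanish locally. At a point of [C], interior to [D], the nearby points of the
   prescribed set belong to [K], where [h] is continuous. *)
- move=> y Ky V Vy; have [Cy|nCy] := pselect (C y); last first.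
    have N : nbhs y (~` C).
      by apply: open_nbhs_nbhs; split=> //; exact: closed_openC.
    rewrite h'0// in Vy.
    have {}Vy : nbhs y [set z | V (inc (0 : fib A z))].
      exact: (zero_section_continuous Vy).
    by apply: filterS (filterI Vy N) => z [Vz /h'0 ->].
  have Dy := CD y Cy; case: Ky => [Ky|//].
  pose x : sub_groupoid K := exist _ y (mem_set Ky).
  have chx : nbhs x [set z | V (inc (h' (set_val z)))].
    have -> : [set z : sub_groupoid K | V (inc (h' (set_val z)))] =
        [set z | V (set_val (inc (h z)))].
      by apply/funext => z /=; rewrite h'K.
    apply: (comp_continuous ch (@set_val_continuous _ _)).
    by rewrite [X in nbhs X](_ : _ = inc (h' (set_val x))) // h'K.
  move: chx; rewrite nbhsE => -[_ [[N oN <-] Ny] NV].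
  have {Ny}Ny : nbhs y N by exact: open_nbhs_nbhs.
  apply: filterS (filterI Ny (nbhs_interior Dy)) => z [Nz Dz] [Kz|//].
  exact: (NV (exist _ z (mem_set Kz)) Nz).
- by move=> z nDz; apply: h'0 => /CD/interior_subset.
have fD z : ~ D z -> f z = 0.
  by move=> nDz; rewrite fh ?h'0//; [move=> /CD/interior_subset|exact: subD].
have suppD : [set x | f x != 0] `<=` D.
  by move=> x; apply: contraPP => /fD fx0; rewrite /= fx0 eqxx.
exists f; split.
- split=> //; apply: (subclosed_compact _ kD); first exact: closed_closure.
  have /closure_id -> := compact_closed hG kD.
  exact: closureS.
- exact: subset_trans DW.
- apply: functional_extensionality_dep => x; rewrite /sec_restrict fh ?h'K//.
  by left; exact: set_type_in.
Qed.

End ExtendSections.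

(** * Boundedness of states *)

Section StateContinuity.
Variables (R : realType) (B : cstarAlgebra R) (phi : B -> R[i]).
Hypothesis phi_state : is_state phi.

Lemma stateZ (k : R[i]) (b : B) : phi (k *: b) = k * phi b.
Proof.
have [lin _ _] := phi_state; have phi0 : phi 0 = 0.
  have := lin 1 0 0; rewrite scaler0 addr0 mul1r.
  by move=> /eqP; rewrite -subr_eq subrr => /eqP.
by have := lin k b 0; rewrite addr0 phi0 addr0.
Qed.

Lemma stateB (a b : B) : phi (a - b) = phi a - phi b.
Proof.
have [lin _ _] := phi_state.
by rewrite addrC -scaleN1r lin mulN1r addrC.
Qed.

Lemma state_bound (b : B) : rnorm (phi b : R[i]^o) <= rnorm b.
Proof.
have [_ _ sup1] := phi_state.
set N := [set _ | _ in _] in sup1.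
(* [sup] is [0] on sets without a supremum, so the value [1] forces [N] to be bounded. *)
have hsN : has_sup N.
  apply: contrapT => /sup_out N0; move: sup1; rewrite N0 => /eqP.
  by rewrite eq_sym oner_eq0.
have le1 v : rnorm v <= 1 -> rnorm (phi v : R[i]^o) <= 1.
  move=> v1; rewrite -[X in _ <= X]sup1.
  by apply: sup_upper_bound => //; exists v.
have [b0|b0] := eqVneq (rnorm b) 0.
  have -> : b = 0 by apply/eqP; rewrite -normr_eq0 normrE b0.
  by have := stateZ 0 0; rewrite scale0r mul0r => ->; rewrite !rnorm0.
have bgt0 : 0 < rnorm b by rewrite lt_neqAle eq_sym b0 rnorm_ge0.
rewrite -[X in _ <= X]mulr1 -ler_pdivrMl//.
have <- : rnorm (phi ((rnorm b)^-1%:C *: b) : R[i]^o) =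
    (rnorm b)^-1 * rnorm (phi b : R[i]^o).
  by rewrite stateZ (@rnormZ _ (R[i]^o)) gtr0_norm ?invr_gt0.
by apply: le1; rewrite rnormZ gtr0_norm ?invr_gt0// mulVf.
Qed.

Lemma cs_mul_bound (a b : B) : rnorm (cs_mul a b) <= rnorm a * rnorm b.
Proof.
by rewrite -lecR rmorphM/= -!normrE; exact: (cstar_normM (cs_axioms B)).
Qed.

Lemma cs_mulB (a a' b : B) : cs_mul (a - a') b = cs_mul a b - cs_mul a' b.
Proof.
have := bilinear_l (cstar_bilinear (cs_axioms B)) (-1) a' a b.
by rewrite !scaleN1r addrC => ->; rewrite addrC.
Qed.

Lemma cs_mulBr (a b b' : B) : cs_mul a (b - b') = cs_mul a b - cs_mul a b'.
Proof.
have := bilinear_r (cstar_bilinear (cs_axioms B)) (-1) a b' b.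
by rewrite !scaleN1r addrC => ->; rewrite addrC.
Qed.

Lemma state_commute_dense (S : set B) (b : B) : closure S = setT ->
  (forall a, S a -> phi (cs_mul a b) = phi (cs_mul b a)) ->
  forall a, phi (cs_mul a b) = phi (cs_mul b a).
Proof.
move=> dS comm a; apply/eqP; rewrite -subr_eq0.
suff : rnorm (phi (cs_mul a b) - phi (cs_mul b a) : R[i]^o) = 0.
  by move=> h; rewrite -(@normr_eq0 _ (R[i]^o)) normrE h.
apply/eqP; rewrite eq_le rnorm_ge0 andbT; apply/ler_addgt0Pr => t t0.
have b0 : 0 <= rnorm b := rnorm_ge0 b.
(* Replacing [a] by [a'] changes each of the two products by at most [rnorm (a - a') * rnorm b]; the
   [+ 1] keeps the denominator positive. *)
pose d := t / (2 * rnorm b + 1).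
have d0 : 0 < d by rewrite divr_gt0//; lra.
have : closure S a by rewrite dS.
move=> /(_ [set a' | rnorm (a' - a) < d])[|a' [Sa' aa']].
  by apply/nbhs_rnormP; exists d.
have -> : phi (cs_mul a b) - phi (cs_mul b a) =
    phi (cs_mul (a - a') b) - phi (cs_mul b (a - a')).
  by rewrite cs_mulB cs_mulBr !stateB (comm a')//; ring.
have := rnormD (phi (cs_mul (a - a') b) : R[i]^o) (- phi (cs_mul b (a - a'))).
rewrite rnormN.
have := state_bound (cs_mul (a - a') b); have := cs_mul_bound (a - a') b.
have := state_bound (cs_mul b (a - a')); have := cs_mul_bound b (a - a').
have : rnorm (a - a') * (2 * rnorm b + 1) <= t.
  by rewrite -ler_pdivlMr; [rewrite rnormBC ltW|lra].
have := rnorm_ge0 (a - a'); lra.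
Qed.

End StateContinuity.

(** * KMS states on fixed points of the dynamics *)

Section KMS.
Variables (R : realType) (B : cstarAlgebra R) (sigma : R -> B -> B).

(** A fixed element has a constant entire extension, so the KMS condition at every [beta] says that
    the state commutes on it. Uniqueness of limits passes this to [psi]. *)
Lemma KMS_infty_fixed_commute (psi : B -> R[i]) (a b : B) :
  is_KMS_infty sigma psi ->
  (forall t, sigma t a = a) -> (forall t, sigma t b = b) ->
  psi (cs_mul a b) = psi (cs_mul b a).
Proof.
move=> [_ [I [le [beta [net [[[i0] lerefl letrans ledir] kms _ cvgnet]]]]]].
move=> sa sb.
have entire x : (forall t, sigma t x = x) ->
    is_entire_extension sigma x (fun=> x).
  by move=> sx; split=> [z|t]; [exact: derivable_cst|].
have net_comm i : net i (cs_mul a b) = net i (cs_mul b a).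
  by have [_ kmsi] := kms i; exact: (kmsi _ _ _ _ (entire _ sa) (entire _ sb)).
set F := filter_from _ _ in cvgnet.
have FF : ProperFilter F.
  apply: filter_from_proper; last by move=> i _; exists i; exact: lerefl.
  apply: filter_from_filter; first by exists i0.
  move=> i j _ _; have [k [ik jk]] := ledir i j; exists k => // l kl.
  by split; exact: letrans kl.
have ca := cvgnet (cs_mul a b); have cb := cvgnet (cs_mul b a).
have eq_net : (fun i => net i (cs_mul a b) : R[i]^o) =
    (fun i => net i (cs_mul b a)) by apply/funext => i; exact: net_comm.
rewrite eq_net in ca.
exact: (cvg_unique (@norm_hausdorff _ (R[i]^o)) ca cb).
Qed.

End KMS.

(** * Comparison of the two states on products *)

Section Multiplicativity.
Variables (R : realType) (G : topGroupoid) (A : fellBundle R G)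
  (c : cocycle R G).
Hypotheses (lcG : locally_compact [set: G]) (hG : hausdorff_space G).
Hypothesis (eG : etale G).
Variables (B : cstarAlgebra R) (iota : bsection A -> B).
Hypothesis (B_full : is_full_cstar_algebra iota).
Let K := reduction (boundary c).
Variables (BZ : cstarAlgebra R) (iotaZ : bsection (restriction A K) -> BZ).
Hypothesis (BZ_full : is_full_cstar_algebra iotaZ).
Variables (phi : BZ -> R[i]) (psi : B -> R[i]).
Hypotheses (phi_lin : scalar phi) (psi_lin : scalar psi).
Hypothesis psi_phi : forall f : bsection A, Cc f ->
  psi (iota f) = phi (iotaZ (sec_restrict f)).

(** If [f] is supported in a bisection, its convolution with [g] is in [Cc] and [sec_conv_restrict]
    gives the formula. Both sides are additive in [f], and bump functions cut a general [f] into
    such pieces. *)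
Lemma state_sec_mul (f g : bsection A) : Cc f -> Cc g ->
  [set x | f x != 0] `<=` [set x | c x = 0] ->
  psi (cs_mul (iota f) (iota g)) =
  phi (cs_mul (iotaZ (sec_restrict f)) (iotaZ (sec_restrict g))).
Proof.
move=> cf cg fc; have cK : closed K := reduction_closed eG.
pose good (f : bsection A) := psi (cs_mul (iota f) (iota g)) =
  phi (cs_mul (iotaZ (sec_restrict f)) (iotaZ (sec_restrict g))).
pose adm (f : bsection A) := Cc f /\ [set x | f x != 0] `<=` [set x | c x = 0].
have good_bisection U f' : open U -> set_inj U (@grng G) -> adm f' ->
    closure [set x | f' x != 0] `<=` U -> good f'.
  move=> oU injU [cf' f'c] f'U.
  rewrite /good -(full_mul B_full)// psi_phi; last exact: Cc_sec_conv f'U.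
  rewrite (sec_conv_restrict _ f'c) (full_mul BZ_full)//;
    exact: Cc_sec_restrict.
have goodD f1 f2 f' : adm f1 -> adm f2 -> (forall x, f' x = f1 x + f2 x) ->
    good f1 -> good f2 -> good f'.
  move=> [cf1 _] [cf2 _] f'E; rewrite /good.
  have -> : f' = sec_add (sec_scale 1 f1) f2.
    apply: functional_extensionality_dep => x.
    by rewrite f'E /sec_add /sec_scale scale1r.
  have -> : sec_restrict (K := K) (sec_add (sec_scale 1 f1) f2) =
    sec_add (sec_scale 1 (sec_restrict f1)) (sec_restrict f2) by [].
  rewrite (full_linear B_full)// (full_linear BZ_full)//;
    do ?exact: Cc_sec_restrict.
  rewrite !(bilinear_l (cstar_bilinear (cs_axioms _))).
  by rewrite phi_lin psi_lin => -> ->.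
(* Decomposition of [f] into sections supported in bisections, phrased without
   finite sums: if sections supported in [S'] are good, so are those supported
   in [S `|` S']. *)
pose P S := forall S', (forall f', adm f' -> [set x | f' x != 0] `<=` S' ->
    good f') ->
  forall f', adm f' -> [set x | f' x != 0] `<=` S `|` S' -> good f'.
have [_ kf] := cf.
(* The induction starts from sections supported in the empty set, which is trivially a bisection. *)
suff /(_ set0) PC : P (closure [set x | f x != 0]).
  apply: PC => //; last by left; exact: subset_closure.
  move=> f' af' f'0; apply: (good_bisection set0) => //.
  - exact: open0.
  - by move=> ? ?; rewrite in_set0.
  have -> : [set x | f' x != 0] = set0 by apply/seteqP; split.
  by rewrite closure0.
apply: (compact_ind (P := P) kf).
- by move=> S' gS' f' af'; rewrite set0U; exact: gS'.
- move=> S T ST PT S' gS' f' af' f'S.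
  by apply: (PT S') => // x /f'S[/ST|]; [left|right].
- move=> S T PS PT S' gS' f' af' f'S; apply: (PS (T `|` S')) => //.
    exact: PT.
  by rewrite setUA.
move=> y _; have [U [oU Uy injU _]] := eG y.
have Uy' : nbhs y U by exact: open_nbhs_nbhs.
have [l [cl _ [F [cF FU lF]] l1]] := bump_function R lcG hG Uy'.
exists [set x | l x = 1] => // S' gS' f' [cf' f'c] f'S.
have adml (m : G -> R) : continuous m -> adm (fun x => (m x)%:C *: f' x).
  move=> cm; split; first exact: Cc_sec_mul.
  apply: subset_trans f'c => x /=; apply: contraNneq => ->.
  by rewrite scaler0.
have cl' : continuous (fun x => 1 - l x).
  by move=> x; apply: cvgB; [exact: cvg_cst|exact: cl].
(* The first piece is supported in the bisection [U]; the second vanishes where [l = 1], so it is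
   nonzero only on [S']. *)
apply: (goodD (fun x => (l x)%:C *: f' x) (fun x => (1 - l x)%:C *: f' x)).
- exact: adml.
- exact: (adml (fun x => 1 - l x)).
- by move=> x; rewrite -scalerDl -rmorphD/= subrKC scale1r.
- apply: (good_bisection U) => //; first exact: adml.
  apply: subset_trans FU; have /closure_id -> := cF.
  apply: closureS => x /=; apply: contraNP => /lF ->.
  by rewrite scale0r.
- apply: gS'; first exact: (adml (fun x => 1 - l x)).
  move=> x /= lfx; have f'x : f' x != 0.
    by apply: contraNneq lfx => ->; rewrite scaler0.
  have [|//] := f'S x f'x; move=> /= lx.
  by move: lfx; rewrite lx subrr scale0r eqxx.
Qed.

End Multiplicativity.

(** * Traciality of the boundary state *)

Theorem corollary4p14 (R : realType) (G : topGroupoid) (A : fellBundle R G)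
    (c : cocycle R G)
    (G_locally_compact : locally_compact [set: G])
    (G_hausdorff : hausdorff_space G)
    (G_second_countable : @second_countable G)
    (G_etale : etale G)
    (B : cstarAlgebra R) (iota : bsection A -> B)
    (B_full : is_full_cstar_algebra iota)
    (sigma : R -> B -> B)
    (sigma_c : is_cocycle_dynamics c iota sigma)
    (Z_nonempty : boundary c !=set0)
    (kernel_etale : etale (sub_groupoid (coc_kernel c)))
    (BZ : cstarAlgebra R)
    (iotaZ : bsection (restriction A (reduction (boundary c))) -> BZ)
    (BZ_full : is_full_cstar_algebra iotaZ)
    (phi : BZ -> R[i]) (phi_state : is_state phi)
    (psi : B -> R[i]) (psi_ground : is_ground_state sigma psi)
    (psi_phi : forall f : bsection A, Cc f ->
       psi (iota f) = phi (iotaZ (sec_restrict f))) :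
  is_KMS_infty sigma psi -> is_tracial phi.
Proof.
move=> kms; have [_ sigma_iota] := sigma_c.
have [[psi_lin _ _] _] := psi_ground; have [phi_lin _ _] := phi_state.
have clK := coc_kernel_clopen G_etale kernel_etale.
have cZ := reduction_closed G_etale (c := c).
have fixed f : Cc f -> [set x | f x != 0] `<=` [set x | c x = 0] ->
    forall t, sigma t (iota f) = iota f.
  move=> cf fc t; rewrite sigma_iota//; congr iota.
  (* Where [f] is nonzero the phase is [cos 0 + i sin 0 = 1]. *)
  apply: functional_extensionality_dep => x; rewrite /sec_dynamics.
  have [->|/fc /= ->] := eqVneq (f x) 0; first by rewrite scaler0.
  by rewrite mulr0 cos0 sin0 scale1r.
have comm h k : Cc h -> Cc k ->
    phi (cs_mul (iotaZ h) (iotaZ k)) = phi (cs_mul (iotaZ k) (iotaZ h)).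
  have ext := Cc_extension G_locally_compact G_hausdorff cZ clK
    (reduction_sub_kernel (c := c)).
  move=> /ext[f [cf fc <-]] /ext[g [cg gc <-]].
  have mul := state_sec_mul G_locally_compact G_hausdorff G_etale B_full
    BZ_full phi_lin psi_lin psi_phi.
  rewrite -!mul//.
  exact: KMS_infty_fixed_commute kms (fixed _ _ _) (fixed _ _ _).
move=> a b.
have comm_dense := state_commute_dense phi_state (full_dense BZ_full).
(* Density is used in one variable at a time, with the other fixed. *)
apply: (comm_dense) => _ [h ch <-].
by apply/esym; apply: (comm_dense) => _ [k ck <-]; exact: comm.
Qed.
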